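(* For $n\ge 2$ let $\mu_n:=\frac{1}{n-1}\sum_{k=1}^{n-1}\delta_{x_{n,k}}$, where $0<x_{n,1}\le\cdots\le x_{n,n-1}<1$ are the zeros of $\widetilde{\Xi}_n$, and let $F_n(x):=\mu_n((-\infty,x])$, $x\in\mathbb{R}$, be the distribution function of $\mu_n$. Then, as $n\to\infty$, $F_n(x)$ converges pointwise on $\mathbb{R}$ to the function $$F(x):=\begin{cases}0, & x\le 0,\\[1mm] \dfrac{2}{\pi}\arctan\!\left(\dfrac{1}{\pi}\log\dfrac{1+\sqrt{x}}{1-\sqrt{x}}\right), & 0<x<1,\\[2mm] 1, & x\ge 1.\end{cases}$$ In particular, the empirical distribution functions $F_n$ associated with the real zeros of $\widetilde{\Xi}_n$ in $(0,1)$ converge to $F$ at every continuity point of $F$.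
   Context: $B_m(z)$ ($m\ge 0$) denotes the Eulerian polynomial of type $B$ of degree $m$, i.e. $B_m(z)=\sum_{k=0}^m b_{m,k}z^k$ where $b_{m,k}$ is the Eulerian number of type $B$ (the number of signed permutations of $\{1,\dots,m\}$ with exactly $k$ type-$B$ descents). Equivalently, $B_0(z)=1$ and $B_m(z)=((2m-1)z+1)B_{m-1}(z)+2z(1-z)B_{m-1}'(z)$ for $m\ge1$. For $n\ge 1$, $$\Xi_n(x)=\frac{(-1)^{n+1}}{2^{4n-1}(2n-1)!}\,\frac{(1+x)^{2n-1}}{x}\,B_{2n-1}\!\left(-\frac{1-x}{1+x}\right),$$ which is an even polynomial in $x$ (removable singularities being filled in). For $n\ge2$, $\widetilde{\Xi}_n(x):=\Xi_n(\sqrt{x})$; this is a real polynomial of degree $n-1$, all of whose $n-1$ zeros (listed with multiplicity) lie in $(0,1)$. $\delta_a$ denotes the Dirac mass at $a$. *)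

(* Defs.v *)
From HB Require Import structures.
From mathcomp Require Import all_boot all_order all_algebra all_fingroup.
From mathcomp Require Import polyrcf.
From mathcomp Require Import all_classical all_reals all_analysis.
Set Implicit Arguments.
Unset Strict Implicit.
Unset Printing Implicit Defensive.
Import Order.TTheory GRing.Theory Num.Theory.
Import numFieldNormedType.Exports.

Local Open Scope classical_set_scope.
Local Open Scope ring_scope.

(* (s, e) encodes the signed permutation i |-> (-1)^(e i) * s(i) of
   {1, ..., m}; the shift by one accounts for 'I_m starting at 0. *)
Definition signed_perm (m : nat) : finType := ('S_m * {ffun 'I_m -> bool})%type.

(* The word 0, w(1), ..., w(m): the leading 0 is the type-B convention
   w(0) = 0. *)
Definition signed_word (m : nat) (w : signed_perm m) : seq int :=
  0 :: [seq (-1) ^+ w.2 i * (w.1 i).+1%:Z | i <- enum 'I_m].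

Definition desB (m : nat) (w : signed_perm m) : nat :=
  #|[pred i : 'I_m | (signed_word w)`_i.+1 < (signed_word w)`_i]|.

Definition eulerianB (m k : nat) : nat :=
  #|[pred w : signed_perm m | desB w == k]|.

Definition eulerianB_poly (R : realType) (m : nat) : {poly R} :=
  \poly_(k < m.+1) (eulerianB m k)%:R.

(* Meaningful for x different from 0 and -1, where the quotients are genuine. *)
Definition Xi (R : realType) (n : nat) (x : R) : R :=
  (-1) ^+ n.+1 / (2 ^+ (4 * n - 1) * ((2 * n - 1)`!)%:R)
  * ((1 + x) ^+ (2 * n - 1) / x)
  * (eulerianB_poly R (2 * n - 1)).[- ((1 - x) / (1 + x))].

(* The polynomial Xi_n(sqrt x).  On x > 0 the expression Xi has no
   singularity, and a polynomial is determined by its values there, so this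
   also fills in the removable singularities. *)
Definition Xi_tilde (R : realType) (n : nat) : {poly R} :=
  xget 0 [set p : {poly R} | forall x : R, 0 < x -> p.[x] = Xi n (Num.sqrt x)].

(* The real zeros, listed in nondecreasing order with multiplicity
   (rootsR lists the distinct ones). *)
Definition real_zeros (R : realType) (p : {poly R}) : seq R :=
  sort <=%R (flatten [seq nseq (mup a p) a | a <- rootsR p]).

(* 0 <= k < n - 1 here indexes the zero x_(n, k + 1).  The default value of
   nth is irrelevant when n >= 2, since then there are n - 1 zeros. *)
Definition zero_Xi (R : realType) (n k : nat) : R :=
  nth 0 (real_zeros (Xi_tilde R n)) k.

Definition mu_zeros (R : realType) (n : nat) : set R -> \bar R :=
  mscale (n.-1%:R^-1)%:nng (msum (fun k => \d_(zero_Xi R n k)) n.-1).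

Definition F_zeros (R : realType) (n : nat) (x : R) : R :=
  fine (mu_zeros n `]-oo, x]).

Definition F_limit (R : realType) (x : R) : R :=
  if x <= 0 then 0
  else if x < 1 then
    2 / pi * atan (1 / pi * ln ((1 + Num.sqrt x) / (1 - Num.sqrt x)))
  else 1.

(* Main.v *)
Require Import Defs.
From mathcomp Require Import all_boot all_order all_algebra all_fingroup.
From mathcomp Require Import polyrcf complex.
From mathcomp Require Import all_classical all_reals all_analysis.
From mathcomp Require Import zify ring lra.
Set Implicit Arguments.
Unset Strict Implicit.
Unset Printing Implicit Defensive.
Import Order.TTheory GRing.Theory Num.Theory.
Import numFieldNormedType.Exports.
Local Open Scope classical_set_scope.
Local Open Scope complex_scope.
Local Open Scope ring_scope.

(** Let L_m(s) = sum_(k >= 1) k^m s^k be the polylogarithm of order -m, a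
rational function whose only pole is s = 1.  Keeping the odd exponents only
produces the type B Eulerian polynomial:
  (L_m(s) - L_m(-s)) / 2 = s B_m(s^2) / (1 - s^2)^(m+1).
For w > 0 and s = exp(-z), z = w + i pi/2, one has s^2 = - exp(-2w), which is
-(1 - x)/(1 + x) for x = tanh w, and -s is the conjugate of s.  Hence, with
m = 2n - 1, the sign of Xi_n(tanh w) is, up to a sign depending on n alone,
that of Im L_m(exp(-z)).

The function z |-> L_m(exp(-z)) is the sum of its principal parts,
  L_m(exp(-z)) = m! sum_(k in Z) (z + 2 pi i k)^(-m-1)          (Lipschitz),
and the term k = 0 dominates for large m.  Writing z = rho exp(i t), that is
w = (pi/2) cot t with 0 < t < pi/2, the imaginary part of this term is
- m! rho^(-2n) sin(2n t), so Xi_n alternates in sign along the angles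
t_j = (2j+1) pi / (4n), as soon as the other terms are negligible; this is
uniform in t >= const > 0 (Xi_tilde_node_sign).  The corresponding points
x_j = tanh((pi/2) cot t_j)^2 are quantiles of the limit law:
F(x_j) = 1 - (2j+1)/(2n) (F_limit_node).  So for each c > 0 and large n, the
polynomial Xi_tilde has a zero between x_(j+1) and x_j for every j with
c n <= j < n - 1, and since its degree is at most n - 1 this locates all its
zeros but c n + O(1) of them.  Therefore |F_n - F| <= c + O(1/n)
(count_zeros_close), for every c > 0.

The expansion over the poles is obtained from the duplication formula
2^(m+1) L_m(s^2) = L_m(s) + L_m(-s), iterated N times: it writes
L_m(exp(-z)) as 2^(-N(m+1)) times the sum of the values of L_m at exp(-u), for
the 2^N points u = (z + 2 pi i j) / 2^N of the strip |Im u| <= pi.  Near u = 0,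
L_m(exp(-u)) = m!/u^(m+1) + O(|u|^(-m)), and the errors add up
to O(2^(-N)) (polylog_near1, polylog_partial_sum).

The recurrence B_(m+1) = ((2m+1)X + 1) B_m + 2X(1-X) B_m' needed to relate B_m
to L_m comes from inserting the letter m+1 or -(m+1) into the word of a signed
permutation (sum_desB_rec). *)

(** * Descents of signed permutations *)

(** Descents of the word x :: s, counted by recursion so that inserting a
letter can be followed along the word. *)
Fixpoint descents (x : int) (s : seq int) : nat :=
  if s is y :: s' then ((y < x)%R + descents y s')%N else 0%N.

Lemma descents_sum (x : int) (s : seq int) :
  descents x s = (\sum_(i < size s) ((x :: s)`_i.+1 < (x :: s)`_i)%R)%N.
Proof.
elim: s x => [|y s IHs] x /=; first by rewrite big_ord0.
by rewrite big_ord_recl IHs.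
Qed.

Lemma descents_le_size (x : int) (s : seq int) : (descents x s <= size s)%N.
Proof.
elim: s x => [|y s IHs] x //=; rewrite -add1n leq_add //.
by case: (y < x).
Qed.

(** A letter larger than all others creates a descent exactly when it is
inserted at an ascent, but none at the end; a letter smaller than all others
creates one exactly when inserted at an ascent or at the end. So each of the d
descents of the word keeps the count for both letters, as does the final
position for the large one, and all other insertions add one. The offset a
carries the descents already passed in the induction. *)
Lemma sum_insertions (V : nmodType) (g : nat -> V) (M x : int) (s : seq int) (a : nat) :
  all (fun y => (- M < y < M)) (x :: s) ->
  \sum_(i < (size s).+1)
     (g (a + descents x (take i s ++ M :: drop i s))%N
      + g (a + descents x (take i s ++ - M :: drop i s))%N)
  = g (a + descents x s)%N *+ (2 * descents x s).+1
    + g (a + descents x s).+1 *+ (2 * (size s - descents x s)).+1.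
Proof.
elim: s x a => [|y s IHs] x a /=.
  rewrite andbT => /andP[Mx xM]; rewrite big_ord_recl big_ord0 /= addr0.
  by rewrite (ltNge M x) (ltW xM) Mx /= !addn0 addn1 !mulr1n.
case/and3P=> /andP[Mx xM] /andP[My yM] sM.
rewrite big_ord_recl /=.
rewrite (ltNge M x) (ltW xM) yM Mx (ltNge y (- M)) (ltW My) /= !add0n.
under eq_bigr => i _ do rewrite /= !addnA.
rewrite IHs /= ?My ?yM //.
have := descents_le_size y s; set d := descents y s => d_le.
rewrite add1n addnS.
case: (y < x) => /=; rewrite ?addn0 ?addn1 ?add0n ?add1n ?addSn ?addnS.
  rewrite subSS (_ : (2 * d.+1).+1 = (2 * d).+1.+2) ?[in RHS]mulrS; last lia.
  by rewrite !mulrS !addrA.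
rewrite subSn // (_ : (2 * (size s - d).+1).+1 = (2 * (size s - d)).+1.+2); last lia.
by rewrite !mulrS addrCA !addrA; do ![congr (_ + _)]; rewrite addrC !addrA.
Qed.

Lemma desB_descents (m : nat) (w : signed_perm m) :
  desB w = descents 0 (behead (signed_word w)).
Proof.
rewrite descents_sum size_map size_enum_ord /desB -sum1_card big_mkcond /=.
by apply: eq_bigr => i _; rewrite inE /signed_word /=; case: (_ < _).
Qed.

Lemma signed_word_bound (m : nat) (w : signed_perm m) :
  all (fun y : int => - m.+1%:Z < y < m.+1%:Z) (signed_word w).
Proof.
apply/allP => y; rewrite inE => /predU1P[-> //|/mapP[i _ ->]].
have := ltn_ord (w.1 i); case: (w.2 i); rewrite ?expr1 ?expr0 ?mulN1r ?mul1r; lia.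
Qed.

(** On words: inserts at position p.1.2 the letter m+1, negated if p.2 holds.
*)
Definition insert_letter (m : nat) (p : signed_perm m * 'I_m.+1 * bool) :
    signed_perm m.+1 :=
  (lift_perm p.1.2 ord_max p.1.1.1,
   [ffun k => if unlift p.1.2 k is Some j then p.1.1.2 j else p.2]).

Lemma insert_letter_inj (m : nat) : injective (@insert_letter m).
Proof.
move=> [[[s e] i] b] [[[t f] j] c] [/= /permP eq_p /ffunP eq_e].
(* i is the only index sent to the new largest value *)
have eq_ij : i = j.
  apply/eqP; have := eq_p i; rewrite lift_perm_id.
  case: (unliftP j i) => [k -> |-> //]; rewrite lift_perm_lift => /esym/eqP.
  by rewrite eq_sym (negPf (neq_lift _ _)).
subst j; congr (_, _, _, _).
- apply/permP => k; have := eq_p (lift i k); rewrite !lift_perm_lift.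
  exact: lift_inj.
- by apply/ffunP => k; have := eq_e (lift i k); rewrite !ffunE liftK.
- by have := eq_e i; rewrite !ffunE unlift_none.
Qed.

(** Injectivity suffices, as both sides have 2^(m+1) (m+1)! elements. *)
Lemma insert_letter_bij (m : nat) : bijective (@insert_letter m).
Proof.
apply: inj_card_bij (@insert_letter_inj m) _.
rewrite !card_prod !card_Sn !card_ffun !card_ord card_bool factS expnS; lia.
Qed.

Lemma nth_insertion (T : Type) (x0 c : T) (s : seq T) (i j : nat) :
  (i <= size s)%N ->
  nth x0 (take i s ++ c :: drop i s) (bump i j) = nth x0 s j.
Proof.
move=> i_le; rewrite nth_cat size_takel // /bump; case: (leqP i j) => ij.
  by rewrite add1n ltnNge leqW //= subSn //= nth_drop subnKC.
by rewrite add0n ij nth_take.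
Qed.

Lemma signed_word_insert (m : nat) (w : signed_perm m) (i : 'I_m.+1) (b : bool) :
  let u := behead (signed_word w) in
  behead (signed_word (insert_letter (w, i, b))) =
  take i u ++ (if b then - m.+1%:Z else m.+1%:Z) :: drop i u.
Proof.
move=> u; have size_u : size u = m by rewrite size_map size_enum_ord.
have i_le : (i <= size u)%N by rewrite size_u -ltnS ltn_ord.
apply: (@eq_from_nth _ 0).
  rewrite size_map size_enum_ord size_cat /= size_takel // size_drop size_u.
  by rewrite addnS subnKC // -ltnS.
move=> k; rewrite size_map size_enum_ord => k_lt.
rewrite (nth_map ord0) ?size_enum_ord //.
have -> : nth ord0 (enum 'I_m.+1) k = Ordinal k_lt.
  by apply: val_inj; rewrite /= nth_enum_ord.
rewrite -[in RHS](erefl : val (Ordinal k_lt) = k); move: (Ordinal k_lt) => {k_lt}k.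
case: (unliftP i k) => [j -> |->] /=.
  rewrite ffunE liftK lift_perm_lift lift_max nth_insertion //.
  rewrite (nth_map j) ?size_enum_ord //.
  by have -> : nth j (enum 'I_m) j = j by apply: val_inj; rewrite /= nth_enum_ord.
rewrite ffunE unlift_none lift_perm_id nth_cat size_takel // ltnn subnn /=.
by case: b; rewrite ?mulN1r ?mul1r.
Qed.

(** Every signed permutation of size m+1 arises in exactly one way by inserting
the letter of largest absolute value. With g d = X^d this is the recurrence of
the Eulerian polynomials; an arbitrary statistic g is kept because the symmetry
below needs another one. *)
Lemma sum_desB_rec (V : nmodType) (g : nat -> V) (m : nat) :
  \sum_(w : signed_perm m.+1) g (desB w) =
  \sum_(w : signed_perm m) (g (desB w) *+ (2 * desB w).+1
                            + g (desB w).+1 *+ (2 * (m - desB w)).+1).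
Proof.
rewrite (reindex _ (onW_bij _ (@insert_letter_bij m))) /=.
rewrite -(pair_bigA _ (fun p b => g (desB (insert_letter (p, b))))) /=.
rewrite -(pair_bigA _ (fun w i =>
  \sum_(b : bool) g (desB (insert_letter (w, i, b))))) /=.
apply: eq_bigr => w _.
have size_u : size (behead (signed_word w)) = m.
  by rewrite size_map size_enum_ord.
have := @sum_insertions V g m.+1%:Z 0 (behead (signed_word w)) 0
  (signed_word_bound w).
rewrite size_u -desB_descents !add0n => <-.
apply: eq_bigr => i _; rewrite big_bool /= addrC.
by rewrite !desB_descents !signed_word_insert.
Qed.

Lemma desB_le (m : nat) (w : signed_perm m) : (desB w <= m)%N.
Proof. by rewrite /desB -[leqRHS]card_ord max_card. Qed.

(** The numbers of descents and of ascents are equidistributed: the recurrence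
above is invariant under exchanging d and m - d. *)
Lemma sum_desB_sym (V : nmodType) (m : nat) (g : nat -> V) :
  \sum_(w : signed_perm m) g (desB w) = \sum_(w : signed_perm m) g (m - desB w)%N.
Proof.
elim: m g => [|m IHm] g.
  by apply: eq_bigr => w _; have := desB_le w; rewrite leqn0 => /eqP ->.
rewrite sum_desB_rec (IHm (fun d => g d *+ (2 * d).+1 + g d.+1 *+ (2 * (m - d)).+1)).
rewrite (sum_desB_rec (fun d => g (m.+1 - d)%N)); apply: eq_bigr => w _.
have d_le := desB_le w.
by rewrite subKn // subSS subSn // addrC.
Qed.

Lemma sum_desB0 (V : nmodType) (g : nat -> V) :
  \sum_(w : signed_perm 0) g (desB w) = g 0%N.
Proof.
rewrite (eq_bigr (fun=> g 0%N)); last first.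
  by move=> w _; have := desB_le w; rewrite leqn0 => /eqP ->.
by rewrite sumr_const card_prod card_Sn card_ffun card_ord mulr1n.
Qed.

(** * Eulerian polynomials of type B and polylogarithms of negative order *)

(** The Eulerian polynomial of type B over an arbitrary ring: it is evaluated
both at real and at complex points. *)
Definition desB_poly (A : comNzRingType) (m : nat) : {poly A} :=
  \sum_(w : signed_perm m) 'X^(desB w).

Lemma eulerianB_polyE (R : realType) (m : nat) :
  eulerianB_poly R m = desB_poly R m.
Proof.
apply/polyP => k; rewrite coef_poly coef_sum.
under eq_bigr => w _ do rewrite coefXn.
rewrite -natr_sum ltnS; case: leqP => [_|m_lt].
  by rewrite /eulerianB -sum1_card big_mkcond; congr (_%:R); apply: eq_bigr => w _;
     rewrite inE eq_sym; case: (_ == _).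
rewrite big1 // => w _; case: eqP => // k_des.
by have := desB_le w; rewrite -k_des leqNgt m_lt.
Qed.

Lemma desB_poly0 (A : comNzRingType) : desB_poly A 0 = 1.
Proof. by rewrite /desB_poly (sum_desB0 (fun d => 'X^d)). Qed.

Lemma desB_polyS (A : comNzRingType) (m : nat) :
  desB_poly A m.+1 =
  ((2 * m).+1%:R * 'X + 1) * desB_poly A m
  + 2%:R * 'X * (1 - 'X) * (desB_poly A m)^`().
Proof.
rewrite /desB_poly (sum_desB_rec (fun d => 'X^d)) raddf_sum /= !mulr_sumr -big_split /=.
apply: eq_bigr => w _; have := desB_le w; move: (desB w) => d d_le.
rewrite -(subnK d_le) addnK; move: (m - d)%N => k {d_le}.
rewrite derivXn; case: d => [|d]; first by rewrite !mulr0n; ring.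
by rewrite /= !exprS; ring.
Qed.

(** Numerator of L_m(s) = sum_(k >= 1) k^m s^k = polylog_num(s) / (1-s)^(m+1);
the recursion is the effect of the operator s d/ds on this fraction. *)
Fixpoint polylog_num (A : comNzRingType) (m : nat) : {poly A} :=
  if m is p.+1 then
    'X * ((1 - 'X) * (polylog_num A p)^`() + p.+1%:R * polylog_num A p)
  else 'X.

Definition comp_poly_rules := (comp_polyM, comp_polyD, comp_polyB, comp_polyC,
  comp_polyX, rmorph_nat, rmorph1, raddfN).

Definition deriv_rules := (derivM, derivD, deriv_comp, deriv_exp, derivC, derivN,
  derivB, derivX, derivXn).

(** The operator s d/ds applied to an identity c p / (1-s^2)^(m+1) = q /
(1-s)^(m+1) + r / (1+s)^(m+1), all denominators cleared. *)
Lemma euler_operator_rule (A : comNzRingType) (c : A) (p q r : {poly A}) (m : nat) :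
  c%:P * p = q * (1 + 'X) ^+ m.+1 + r * (1 - 'X) ^+ m.+1 ->
  c%:P * ('X * (1 - 'X^2) * p^`() + (2 * m.+1)%:R * 'X^2 * p) =
  'X * ((1 - 'X) * q^`() + m.+1%:R * q) * (1 + 'X) ^+ m.+2
  + 'X * ((1 + 'X) * r^`() - m.+1%:R * r) * (1 - 'X) ^+ m.+2.
Proof.
move=> eq_p; have := congr1 (@deriv A) eq_p.
rewrite !deriv_rules /= mul0r add0r natrM => d_p.
transitivity ('X * (1 - 'X^2) * (c%:P * p^`()) + 2%:R * m.+1%:R * 'X^2 * (c%:P * p)).
  ring.
rewrite d_p eq_p !exprS; ring.
Qed.

(** The even-exponent part of sum k^m s^k is 2^m sum k^m s^(2k), with
denominators cleared. Both sides follow the same recurrence under s d/ds. *)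
Lemma polylog_num_double (A : comNzRingType) (m : nat) :
  let E := polylog_num A m in
  (2%:R ^+ m.+1)%:P * (E \Po 'X^2)
  = E * (1 + 'X) ^+ m.+1 + (E \Po (- 'X)) * (1 - 'X) ^+ m.+1.
Proof.
elim: m => [|m]; first by rewrite /= !comp_polyX !expr1; ring.
rewrite [polylog_num A m.+1]/=; set E := polylog_num A m => /= /euler_operator_rule.
rewrite !deriv_rules !comp_poly_rules /= !comp_polyX natrM => th.
rewrite [in LHS]exprS polyCM rmorph_nat.
transitivity ((2%:R ^+ m.+1)%:P * ('X * (1 - 'X^2) * ((E^`() \Po 'X^2) * (1 * 'X + 'X * 1)) +
      2%:R * m.+1%:R * 'X^2 * (E \Po 'X^2))); first by ring.
by rewrite th; ring.
Qed.

(** The odd-exponent part of sum k^m s^k is s B_m(s^2) / (1-s^2)^(m+1), with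
denominators cleared: the type B recurrence is that of s d/ds on this fraction.
*)
Lemma desB_poly_polylog (A : comNzRingType) (m : nat) :
  let E := polylog_num A m in
  2%:R%:P * ('X * (desB_poly A m \Po 'X^2))
  = E * (1 + 'X) ^+ m.+1 + - (E \Po (- 'X)) * (1 - 'X) ^+ m.+1.
Proof.
elim: m => [|m].
  by rewrite desB_poly0 /= !comp_poly_rules !expr1 /=; ring.
rewrite [polylog_num A m.+1]/= desB_polyS; set E := polylog_num A m => /= /euler_operator_rule.
rewrite !deriv_rules !comp_poly_rules /= !comp_polyX natrM => th.
set B := desB_poly A m in th *.
transitivity (2%:R * ('X * (1 - 'X^2) * (1 * (B \Po 'X^2) + 'X * ((B^`() \Po 'X^2) * (1 * 'X + 'X * 1))) +
      2%:R * m.+1%:R * 'X^2 * ('X * (B \Po 'X^2)))); first by ring.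
by rewrite th; ring.
Qed.

(** So the leading coefficient of L_m at its pole is m!, as for the integral of
x^m exp(-ux). *)
Lemma polylog_num1 (A : comNzRingType) (m : nat) : (polylog_num A m).[1] = m`!%:R.
Proof.
elim: m => [|m IHm]; first by rewrite hornerX.
rewrite /= !hornerM hornerD !hornerM hornerD hornerN hornerX hornerC subrr mul0r add0r mul1r.
by rewrite IHm factS natrM -polyC_natr hornerC.
Qed.

(** (1+y)^m B_m(-(1-y)/(1+y)) as a polynomial in y, which is the shape in which
B_m enters Xi. *)
Definition desB_homog (A : comNzRingType) (m : nat) : {poly A} :=
  \sum_(w : signed_perm m) ('X - 1) ^+ desB w * ('X + 1) ^+ (m - desB w).

Lemma desB_homogE (F : fieldType) (m : nat) (y : F) : 1 + y != 0 ->
  (1 + y) ^+ m * (desB_poly F m).[- ((1 - y) / (1 + y))] = (desB_homog F m).[y].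
Proof.
move=> y1; rewrite !horner_sum mulr_sumr; apply: eq_bigr => w _.
have := desB_le w; move: (desB w) => d d_le.
rewrite !hornerE -{1}(subnK d_le) exprD -!mulNr opprB expr_div_n.
by rewrite (addrC y 1); field; rewrite expf_neq0.
Qed.

(** Changing y into -y exchanges y - 1 and y + 1 up to sign, hence descents and
ascents. *)
Lemma desB_homog_comp_opp (A : comNzRingType) (m : nat) :
  desB_homog A m \Po (- 'X) = (-1) ^+ m * desB_homog A m.
Proof.
rewrite [in RHS]/desB_homog (sum_desB_sym _ (fun d => ('X - 1) ^+ d * ('X + 1) ^+ (m - d))).
rewrite raddf_sum mulr_sumr; apply: eq_bigr => w _ /=.
have := desB_le w; move: (desB w) => d d_le.
rewrite comp_polyM !rmorphXn /= comp_polyB comp_polyD comp_polyX !rmorph1 subKn //.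
have -> : (-1) ^+ m = (-1) ^+ (m - d) * (-1) ^+ d :> {poly A}.
  by rewrite -exprD subnK.
rewrite -opprD (_ : - 'X + 1 = - ('X - 1)); last by rewrite opprB addrC.
by rewrite (exprNn ('X + 1)) (exprNn ('X - 1)); ring.
Qed.

Lemma size_desB_homog (A : idomainType) (m : nat) : (size (desB_homog A m) <= m.+1)%N.
Proof.
apply: (leq_trans (size_sum _ _ _)); apply/bigmax_leqP => w _.
have := desB_le w; move: (desB w) => d d_le.
apply: (leq_trans (size_polyMleq _ _)).
rewrite -[1]polyC1 size_exp_XsubC -[_%:P]opprK -polyCN size_exp_XsubC; lia.
Qed.

(** An odd polynomial is y times a polynomial in y^2; this is what makes Xi
even and Xi_tilde a polynomial. *)
Lemma odd_desB_homog (R : numFieldType) (m : nat) : odd m ->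
  exists2 p : {poly R}, (size p <= (m.+1)./2)%N & desB_homog R m = (p \Po 'X^2) * 'X.
Proof.
move=> m_odd; exists (odd_poly (desB_homog R m)).
  exact: leq_trans (size_odd_poly _) (half_leq (size_desB_homog _ _)).
have := desB_homog_comp_opp R m; rewrite -signr_odd m_odd expr1 mulN1r.
have := poly_even_odd (desB_homog R m).
move: (even_poly _) (odd_poly _) => e o <-.
rewrite comp_polyD comp_polyM -!comp_polyA comp_polyX comp_Xn_poly sqrrN => eq_eo.
suff -> : e \Po 'X^2 = 0 by rewrite add0r.
(* twice the even part is the sum of the polynomial and its image under X |-> -X *)
have : 2%:R%:P * (e \Po 'X^2) = 0.
  by rewrite (_ : 2%:R%:P * (e \Po 'X^2) = (e \Po 'X^2 + (o \Po 'X^2) * - 'X) + ((e \Po 'X^2) + (o \Po 'X^2) * 'X));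
    [rewrite eq_eo addNr | ring].
by move/eqP; rewrite mulf_eq0 polyC_eq0 pnatr_eq0 /= => /eqP.
Qed.

(** * The polynomial Xi_tilde and the list of its real zeros *)

Lemma poly_eq_pos (R : realFieldType) (p q : {poly R}) :
  (forall x, 0 < x -> p.[x] = q.[x]) -> p = q.
Proof.
move=> pq; apply/eqP; rewrite -subr_eq0; apply/negPn/negP => pq_neq0.
(* more distinct roots 1, 2, ... than the degree allows *)
pose s : seq R := [seq k.+1%:R | k <- iota 0 (size (p - q))].
have := @max_poly_roots _ (p - q) s pq_neq0.
rewrite size_map size_iota ltnn; move=> H; suff: false by [].
apply: H.
  by apply/allP => _ /mapP[k _ ->]; rewrite rootE hornerD hornerN pq ?subrr ?ltr0n.
rewrite map_inj_uniq ?iota_uniq // => i j /eqP.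
by rewrite eqr_nat eqSS => /eqP.
Qed.

(** The polynomial selected by xget exists and is unique, since a polynomial is
determined by its values at the positive reals. *)
Lemma Xi_tilde_poly (R : realType) (n : nat) : (0 < n)%N ->
  (size (Xi_tilde R n) <= n)%N /\
  (forall x : R, 0 < x -> (Xi_tilde R n).[x] = Xi n (Num.sqrt x)).
Proof.
move=> n_gt0; set m := (2 * n - 1)%N.
have [|p size_p Hp] := @odd_desB_homog R m; first by rewrite /m; lia.
pose c : R := (-1) ^+ n.+1 / (2 ^+ (4 * n - 1) * m`!%:R).
have cpE (x : R) : 0 < x -> (c *: p).[x] = Xi n (Num.sqrt x).
  move=> x_gt0; have y_gt0 : 0 < Num.sqrt x by rewrite sqrtr_gt0.
  rewrite -{1}(sqr_sqrtr (ltW x_gt0)); move: (Num.sqrt x) y_gt0 => y y_gt0.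
  have y1 : 1 + y != 0 by rewrite gt_eqF ?addr_gt0.
  have y0 : y != 0 by rewrite gt_eqF.
  have := desB_homogE m y1; rewrite Hp hornerMX horner_comp hornerXn => HB.
  by rewrite /Xi -/m -/c -mulrA (mulrAC _ y^-1) eulerianB_polyE HB mulfK // hornerZ.
have XiE : Xi_tilde R n = c *: p.
  apply: xget_unique => [|q Hq]; first exact: cpE.
  by apply: poly_eq_pos => x x_gt0; rewrite Hq // cpE.
split=> [|x]; rewrite XiE; last exact: cpE.
apply: leq_trans (size_scale_leq _ _) (leq_trans size_p _); rewrite /m; lia.
Qed.

(** The product of the (X - a)^(mup a p) divides p. *)
Lemma mup_sum_le (R : rcfType) (p : {poly R}) (s : seq R) :
  p != 0 -> uniq s -> (\sum_(a <- s) mup a p < size p)%N.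
Proof.
elim: s p => [|a s IHs] p p_neq0 /=; first by rewrite big_nil size_poly_gt0.
case/andP=> a_s s_uniq; rewrite big_cons.
have [k [q]] := multiplicity_XsubC p a; rewrite p_neq0 /= => q_a p_eq.
have q_neq0 : q != 0 by apply: contraNneq q_a => ->; rewrite root0.
have Xk_neq0 : ('X - a%:P) ^+ k != 0 by rewrite expf_neq0 ?polyXsubC_eq0.
rewrite p_eq mupMr // mup_XsubCX eqxx size_Mmonic ?monic_exp ?monicXsubC //.
rewrite size_exp_XsubC addnS /= addnC ltn_add2r.
rewrite (eq_big_seq (fun b => mup b q)) ?IHs // => b b_s.
rewrite mupMl // rootE horner_exp !hornerE expf_neq0 // subr_eq0.
by apply: contraNneq a_s => <-.
Qed.

Lemma mem_rootsR (R : rcfType) (p : {poly R}) (x : R) :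
  p != 0 -> (x \in rootsR p) = root p x.
Proof.
move=> p_neq0; have := roots_on_rootsR p_neq0 x.
by rewrite in_itv.
Qed.

Lemma size_real_zeros (R : realType) (p : {poly R}) :
  (size (real_zeros p) <= (size p).-1)%N.
Proof.
have [->|p_neq0] := eqVneq p 0; first by rewrite /real_zeros rootsR0 size_sort.
rewrite size_sort size_flatten /shape -map_comp sumnE big_map.
under eq_bigr => a _ do rewrite /= size_nseq.
rewrite -ltnS prednK ?size_poly_gt0 //; apply: mup_sum_le => //.
apply: sorted_uniq (sorted_roots _ _ _); [exact: lt_trans|exact: ltxx].
Qed.

Lemma mem_real_zeros (R : realType) (p : {poly R}) (x : R) :
  p != 0 -> root p x -> x \in real_zeros p.
Proof.
move=> p_neq0 px; rewrite mem_sort; apply/flattenP.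
exists (nseq (mup x p) x); first by apply/mapP; exists x => //; rewrite mem_rootsR.
by rewrite mem_nseq eqxx andbT -XsubC_dvd // dvdp_XsubCl.
Qed.

(** * Polylogarithms of negative order near their pole *)

Definition polylog (F : fieldType) (m : nat) (s : F) : F :=
  (polylog_num F m).[s] / (1 - s) ^+ m.+1.

Lemma polylog_double (F : fieldType) (m : nat) (s : F) :
  1 - s != 0 -> 1 + s != 0 ->
  2%:R ^+ m.+1 * polylog m (s ^+ 2) = polylog m s + polylog m (- s).
Proof.
move=> s1 s2; have := congr1 (fun p => p.[s]) (polylog_num_double F m).
rewrite /polylog !(hornerE, horner_comp, hornerXn, horner_exp) /= => HE.
have -> : 1 - s ^+ 2 = (1 - s) * (1 + s) by ring.
rewrite exprMn opprK HE.
by field; rewrite !expf_neq0.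
Qed.

Lemma desB_poly_polylog_eval (F : fieldType) (m : nat) (s : F) :
  1 - s != 0 -> 1 + s != 0 ->
  2%:R * s * (desB_poly F m).[s ^+ 2] / (1 - s ^+ 2) ^+ m.+1
  = polylog m s - polylog m (- s).
Proof.
move=> s1 s2; have := congr1 (fun p => p.[s]) (desB_poly_polylog F m).
rewrite /polylog !(hornerE, horner_comp, hornerXn, horner_exp) /= => HE.
have -> : 1 - s ^+ 2 = (1 - s) * (1 + s) by ring.
rewrite exprMn opprK HE.
by field; rewrite !expf_neq0.
Qed.

Lemma norm_horner_le (F : numFieldType) (p : {poly F}) (s : F) : `|s| <= 1 ->
  `|p.[s]| <= \sum_(i < size p) `|p`_i|.
Proof.
move=> s_le1; rewrite horner_coef (le_trans (ler_norm_sum _ _ _)) //.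
apply: ler_sum => i _; rewrite normrM normrX ler_piMr //.
exact: exprn_ile1.
Qed.

(** With v = 1 - s, the numerator of L_m is m! + O(v), and v = u + O(u^2), so
L_m(s) = m!/u^(m+1) up to O(|u|^(-m)). The hypotheses say that s behaves like
exp(-u), and are stated without the exponential. *)
Lemma polylog_near1 (F : numFieldType) (m : nat) (c d : F) : 0 <= c -> 1 <= d ->
  exists2 K : F, 0 <= K & forall s u : F,
    `|s| <= 1 -> s != 1 -> u != 0 -> `|1 - s - u| <= c * `|u| ^+ 2 ->
    `|u| <= d * `|1 - s| ->
    `|polylog m s - m`!%:R / u ^+ m.+1| <= K / `|u| ^+ m.
Proof.
move=> c_ge0 d_ge1; have d_ge0 : 0 <= d := le_trans ler01 d_ge1.
have [Q HQ] : exists Q, polylog_num F m - m`!%:R%:P = Q * ('X - 1%:P).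
  by apply/factor_theorem; rewrite rootE hornerD hornerN hornerC polylog_num1 subrr.
pose q : F := \sum_(i < size Q) `|Q`_i|.
have q_ge0 : 0 <= q by apply: sumr_ge0.
exists (q * d ^+ m + m`!%:R * (c * d * (m.+1%:R * d ^+ m))).
  by rewrite addr_ge0 ?mulr_ge0 ?exprn_ge0 ?ler0n.
move=> s u s_le1 s_neq1 u_neq0 su us; set v : F := 1 - s in su us *.
have v_neq0 : v != 0 by rewrite subr_eq0 eq_sym.
have v_gt0 : 0 < `|v| by rewrite normr_gt0.
have u_gt0 : 0 < `|u| by rewrite normr_gt0.
have vV : `|v|^-1 <= d / `|u|.
  by rewrite ler_pdivlMr // ler_pdivrMl // mulrC.
(* first the error in the numerator, then the one in the denominator *)
have -> : polylog m s - m`!%:R / u ^+ m.+1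
  = - Q.[s] / v ^+ m + m`!%:R * (v^-1 ^+ m.+1 - u^-1 ^+ m.+1).
  have HEs : (polylog_num F m).[s] = m`!%:R - Q.[s] * v.
    have := congr1 (fun p => p.[s]) HQ.
    by rewrite !hornerE => /eqP; rewrite subr_eq => /eqP ->; rewrite /v; ring.
  rewrite /polylog HEs -/v !exprVn !exprS; move: (v) v_neq0 => t t_neq0.
  by field; rewrite t_neq0 u_neq0 !expf_neq0.
clearbody v; rewrite (le_trans (ler_normD _ _)) // mulrDl lerD //.
  rewrite normrM normrN normfV normrX -mulrA ler_pM //.
  - exact: norm_horner_le.
  - rewrite -!exprVn -exprMn.
    by apply: lerXn2r; rewrite // nnegrE ?mulr_ge0 // invr_ge0 ltW.
rewrite normrM normr_nat -mulrA ler_wpM2l ?ler0n //.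
rewrite subrXX normrM -mulrA ler_pM //.
  have -> : v^-1 - u^-1 = - (v - u) / (v * u) by field; rewrite v_neq0 u_neq0.
  rewrite normrM normrN normfV normrM invfM mulrA mulrAC.
  have -> : c * d = c * `|u| ^+ 2 / `|u| * (d / `|u|) by field; rewrite gt_eqF.
  apply: ler_pM => //; rewrite ?invr_ge0 ?mulr_ge0 ?invr_ge0 //.
  by rewrite ler_wpM2r // invr_ge0.
rewrite (le_trans (ler_norm_sum _ _ _)) //.
rewrite -mulrA mulr_natl -[X in _ *+ X](card_ord m.+1) -sumr_const.
apply: ler_sum => i _; rewrite normrM !normrX !normfV /=.
have i_le : (i <= m)%N by rewrite -ltnS ltn_ord.
move: (nat_of_ord i) i_le => j j_le.
rewrite -(subnK j_le) addnK !exprD; move: (m - j)%N => k.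
have -> : d ^+ k * d ^+ j / (`|u| ^+ k * `|u| ^+ j)
  = (d / `|u|) ^+ k * (d ^+ j * `|u|^-1 ^+ j).
  by rewrite !exprMn !exprVn; field; rewrite !expf_neq0 // gt_eqF.
apply: ler_pM; rewrite ?exprn_ge0 ?invr_ge0 //.
  by apply: lerXn2r; rewrite // nnegrE ?mulr_ge0 // invr_ge0 ltW.
by rewrite ler_peMl ?exprn_ege1 ?exprn_ge0 ?invr_ge0.
Qed.

(** * The complex exponential near the origin *)

Lemma sin_le (R : realType) (x : R) : 0 <= x -> sin x <= x.
Proof.
move=> x_ge0; have [|c _] := @MVT_segment R sin cos 0 x x_ge0.
  exact/continuous_subspaceT/continuous_sin.
rewrite sin0 !subr0 => ->; rewrite ler_piMl //; exact: cos_le1.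
Qed.

Lemma norm_sin_le (R : realType) (x : R) : `|sin x| <= `|x|.
Proof.
wlog x_ge0 : x / 0 <= x => [hw|].
  case: (leP 0 x) => [|x_lt0]; first exact: hw.
  by rewrite -normrN -sinN -[leRHS]normrN hw // oppr_ge0 ltW.
rewrite (ger0_norm x_ge0); have [x_le1|x_gt1] := leP x 1.
  rewrite ger0_norm ?sin_le // sin_ge0_pi // x_ge0 (le_trans x_le1) //.
  by rewrite (le_trans _ (pi_ge2 R)) ?ler1n.
by rewrite (le_trans (sin_max x)) ?ltW.
Qed.

Lemma subr1_cos (R : realType) (x : R) : 1 - cos x = 2%:R * sin (x / 2%:R) ^+ 2.
Proof.
have -> : cos x = cos (x / 2%:R *+ 2) by rewrite -mulr_natr mulfVK.
by rewrite cos_mulr2n cos2sin2; ring.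
Qed.

Lemma subr1_cos_le (R : realType) (x : R) : 1 - cos x <= x ^+ 2 / 2%:R.
Proof.
rewrite subr1_cos; have : sin (x / 2%:R) ^+ 2 <= (x / 2%:R) ^+ 2.
  by rewrite -[leLHS]real_normK ?num_real // -[leRHS]real_normK ?num_real //
     lerXn2r ?nnegrE // norm_sin_le.
by rewrite expr_div_n => h; lra.
Qed.

(** The mean value theorem for t - sin t, whose derivative is 1 - cos t. *)
Lemma subr_sin_le (R : realType) (x : R) : 0 <= x -> x - sin x <= x ^+ 3 / 2%:R.
Proof.
move=> x_ge0; have dF (c : R) : is_derive c 1 (fun t : R => t - sin t) (1 - cos c).
  by apply: is_deriveB.
have [|c] := @MVT_segment R (fun t => t - sin t) (fun t => 1 - cos t) 0 x x_ge0.
  apply: continuous_subspaceT => c; apply: differentiable_continuous.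
  by apply/derivable1_diffP; case: (dF c).
rewrite sin0 !subr0 in_itv /= => /andP[c_ge0 c_le] ->.
have := subr1_cos_le c; have : c ^+ 2 <= x ^+ 2 by rewrite lerXn2r ?nnegrE.
move=> h1 h2; rewrite (_ : x ^+ 3 / 2%:R = x ^+ 2 / 2%:R * x); last by rewrite exprS; ring.
by rewrite ler_wpM2r //; lra.
Qed.

(** A crude form of the concavity of the sine on [0, 2], by duplication from
[0, 1] where sin t >= t/2 and cos t >= 1/2. *)
Lemma sin_ge_quarter (R : realType) (x : R) : 0 <= x <= 2%:R -> x / 4%:R <= sin x.
Proof.
case/andP=> x_ge0 x_le2; pose t := x / 2%:R.
have t_ge0 : 0 <= t by rewrite divr_ge0.
have t_le1 : t <= 1 by rewrite ler_pdivrMr // mul1r.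
have -> : x = t *+ 2 by rewrite -mulr_natr mulfVK.
have sin_ge : t / 2%:R <= sin t.
  have := subr_sin_le t_ge0; have : t ^+ 3 <= t.
    by rewrite exprS ler_piMr // exprn_ile1.
  lra.
have cos_ge : 1 / 2%:R <= cos t.
  have := subr1_cos_le t; have : t ^+ 2 <= 1 by rewrite exprn_ile1.
  lra.
rewrite sin_mulr2n; have : 1 / 2%:R * (t / 2%:R) <= cos t * sin t.
  by rewrite ler_pM // divr_ge0.
lra.
Qed.

Lemma expRN_le (R : realType) (a : R) : 0 <= a -> expR (- a) <= 1 - a + a ^+ 2.
Proof.
move=> a_ge0; have a1 : 0 < 1 + a by lra.
rewrite expRN; apply: (@le_trans _ _ (1 + a)^-1).
  by rewrite lef_pV2 ?posrE ?expR_gt0 // expR_ge1Dx.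
rewrite -div1r ler_pdivrMr //; have : 0 <= a ^+ 3 by rewrite exprn_ge0.
by rewrite (_ : (1 - a + a ^+ 2) * (1 + a) = 1 + a ^+ 3); [lra|ring].
Qed.

(** exp(-(a + ib)). *)
Definition cexpN (R : realType) (a b : R) : R[i] :=
  (expR (- a) * cos b) +i* (- (expR (- a) * sin b)).

Lemma cexpND (R : realType) (a b c d : R) :
  cexpN (a + c) (b + d) = cexpN a b * cexpN c d.
Proof.
rewrite /cexpN opprD expRD sinD cosD; apply/eqP; rewrite eq_complex /=.
by apply/andP; split; apply/eqP; ring.
Qed.

Lemma cexpN_pi (R : realType) (a b : R) : cexpN a (b + pi) = - cexpN a b.
Proof. by rewrite /cexpN sinDpi cosDpi; apply/eqP; rewrite eq_complex /= !mulrN !eqxx. Qed.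

Lemma cexpNX (R : realType) (a b : R) (n : nat) :
  cexpN a b ^+ n = cexpN (a *+ n) (b *+ n).
Proof.
elim: n => [|n IHn]; last by rewrite exprS IHn !mulrS cexpND.
by rewrite !mulr0n /cexpN oppr0 expR0 cos0 sin0 mulr1 mulr0 oppr0.
Qed.

Lemma norm_cexpN (R : realType) (a b : R) : `|cexpN a b| = (expR (- a))%:C.
Proof.
by rewrite normc_def /= sqrrN !exprMn -mulrDr cos2Dsin2 mulr1 sqrtr_sqr ger0_norm ?expR_ge0.
Qed.

Lemma norm_complex_le (R : realType) (x y : R) : `|x +i* y| <= (`|x| + `|y|)%:C.
Proof.
rewrite normc_def lecR /= -[leRHS]ger0_norm ?addr_ge0 // -sqrtr_sqr ler_sqrt ?sqr_ge0 //.
by rewrite sqrrD !real_normK ?num_real // lerD2r lerDl mulrn_wge0 ?mulr_ge0.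
Qed.

Lemma cexpN_near_upper (R : realType) (a b : R) : 0 <= a -> `|b| <= pi ->
  `|1 - cexpN a b - (a +i* b)| <= 3%:R * `|a +i* b| ^+ 2.
Proof.
move=> a_ge0 b_pi; rewrite -add_Re2_Im2 /=.
have -> : 1 - cexpN a b - (a +i* b) =
   (1 - expR (- a) * cos b - a) +i* (expR (- a) * sin b - b).
  by apply/eqP; rewrite eq_complex /= opprK add0r !eqxx.
rewrite (le_trans (norm_complex_le _ _)) //.
have -> : 3%:R * (a ^+ 2 + b ^+ 2)%:C = (3%:R * (a ^+ 2 + b ^+ 2))%:C.
  by rewrite rmorphM rmorph_nat.
rewrite lecR; have e_ge0 := expR_ge0 (- a); have e_le := expRN_le a_ge0.
have e_ge := expR_ge1Dx (- a).
have e_le1 : expR (- a) <= 1 by rewrite expR_le1 oppr_le0.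
move: (expR (- a)) e_ge0 e_le e_ge e_le1 => e e_ge0 e_le e_ge e_le1.
have cos_ge : 0 <= 1 - cos b by rewrite subr_ge0 cos_le1.
have cos_le := subr1_cos_le b.
have re_le : `|1 - e * cos b - a| <= a ^+ 2 + b ^+ 2 / 2%:R.
  have -> : 1 - e * cos b - a = - (e - 1 + a) + e * (1 - cos b) by ring.
  rewrite (le_trans (ler_normD _ _)) // normrN lerD //.
    by rewrite ger0_norm; lra.
  rewrite ger0_norm ?mulr_ge0 // (le_trans _ cos_le) // ler_piMl //.
have sin_le : `|b - sin b| <= 2%:R * b ^+ 2.
  have hw (t : R) : 0 <= t -> t <= pi -> `|t - sin t| <= 2%:R * t ^+ 2.
    move=> t_ge0 t_pi; rewrite ger0_norm ?subr_ge0 ?sin_le //.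
    rewrite (le_trans (subr_sin_le t_ge0)) //.
    rewrite (_ : t ^+ 3 / 2%:R = t / 2%:R * t ^+ 2); last by rewrite exprS; ring.
    rewrite ler_wpM2r ?sqr_ge0 //; have := pihalf_lt2 R; lra.
  case: (leP 0 b) => b0; first by apply: hw => //; rewrite ger0_norm in b_pi.
  have := hw (- b); rewrite sinN sqrrN (_ : - b - - sin b = - (b - sin b)); last by ring.
  by rewrite normrN; rewrite ltr0_norm // in b_pi; apply=> //; rewrite oppr_ge0 ltW.
have im_le : `|e * sin b - b| <= 2%:R * b ^+ 2 + a * `|b|.
  have -> : e * sin b - b = - (e * (b - sin b)) - (1 - e) * b by ring.
  rewrite (le_trans (ler_normB _ _)) // normrN !normrM lerD //.
    by rewrite ger0_norm // (le_trans _ sin_le) // ler_piMl.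
  by rewrite ler_wpM2r // ger0_norm; lra.
have : 2%:R * (a * `|b|) <= a ^+ 2 + b ^+ 2.
  rewrite -(real_normK (num_real b)).
  by have := sqr_ge0 (a - `|b|); rewrite sqrrB; lra.
have := sqr_ge0 a; have := sqr_ge0 b; lra.
Qed.

(** exp(-u) stays away from 1 in proportion to |u| up to the boundary |Im u| =
pi of the period strip: |1 - exp(-u)|^2 = (1 - exp(-a))^2 + 4 exp(-a)
sin(b/2)^2. *)
Lemma cexpN_near_lower (R : realType) (a b : R) : 0 <= a <= 1 / 2%:R -> `|b| <= pi ->
  `|a +i* b| <= 6%:R * `|1 - cexpN a b|.
Proof.
case/andP=> a_ge0 a_le b_pi.
rewrite -(@ler_pXn2r _ 2) ?nnegrE ?mulr_ge0 // exprMn -!add_Re2_Im2 /=.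
rewrite -natrX -(rmorph_nat (real_complex R)) -rmorphM lecR add0r opprK.
have e_le := expRN_le a_ge0; have e_ge := expR_ge1Dx (- a).
move: (expR (- a)) e_le e_ge => e e_le e_ge.
have -> : (1 - e * cos b) ^+ 2 + (e * sin b) ^+ 2
  = (1 - e) ^+ 2 + 2%:R * e * (1 - cos b).
  by rewrite sqrrB !exprMn sin2cos2; ring.
have sin_ge : (b / 8%:R) ^+ 2 <= sin (b / 2%:R) ^+ 2.
  rewrite -[leLHS]real_normK ?num_real // -[leRHS]real_normK ?num_real //.
  rewrite lerXn2r ?nnegrE //.
  have hw (t : R) : 0 <= t -> t <= pi -> `|t / 8%:R| <= `|sin (t / 2%:R)|.
    move=> t_ge0 t_pi; rewrite ger0_norm ?divr_ge0 // (le_trans _ (ler_norm _)) //.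
    have := @sin_ge_quarter R (t / 2%:R); have := pihalf_lt2 R.
    by move=> h1 /(_ _) h2; apply: le_trans (h2 _); [|apply/andP; split]; lra.
  case: (leP 0 b) => b0; first by apply: hw => //; rewrite ger0_norm in b_pi.
  have := hw (- b); rewrite !mulNr sinN !normrN.
  by rewrite ltr0_norm // in b_pi; apply=> //; rewrite oppr_ge0 ltW.
have e1 : a / 2%:R <= 1 - e.
  by have : a ^+ 2 <= 1 / 2%:R * a; [rewrite expr2 ler_wpM2r | lra].
have e1' : (a / 2%:R) ^+ 2 <= (1 - e) ^+ 2.
  by rewrite lerXn2r ?nnegrE //; lra.
have e2 : 1 / 2%:R <= e by lra.
have : 1 / 2%:R * (b / 8%:R) ^+ 2 <= e * sin (b / 2%:R) ^+ 2.
  by rewrite ler_pM // ?divr_ge0 ?sqr_ge0.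
rewrite subr1_cos; rewrite !exprMn in e1' *.
have := sqr_ge0 a; have := sqr_ge0 b; lra.
Qed.

(** * Expansion over the poles *)

Lemma cexpN_lt1 (R : realType) (a b : R) : 0 < a -> `|cexpN a b| < 1.
Proof. by move=> a_gt0; rewrite norm_cexpN ltcR expR_lt1 oppr_lt0. Qed.

Lemma sub1_neq0 (F : numDomainType) (s : F) : `|s| < 1 -> 1 - s != 0.
Proof. by apply: contraTneq => /eqP; rewrite subr_eq0 => /eqP <-; rewrite normr1 ltxx. Qed.

Lemma add1_neq0 (F : numDomainType) (s : F) : `|s| < 1 -> 1 + s != 0.
Proof. by rewrite -normrN -{2}[s]opprK; exact: sub1_neq0. Qed.

(** The duplication formula at s = exp(-(a+ib)/2); the two square roots of
exp(-(a+ib)) differ by a shift of the argument by pi. *)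
Lemma polylog_halve (R : realType) (m : nat) (a b : R) : 0 < a ->
  polylog m (cexpN a b) = (2%:R ^+ m.+1)^-1 *
    (polylog m (cexpN (a / 2%:R) (b / 2%:R)) +
     polylog m (cexpN (a / 2%:R) (b / 2%:R + pi))).
Proof.
move=> a_gt0; have s_lt1 := @cexpN_lt1 R (a / 2%:R) (b / 2%:R) (divr_gt0 a_gt0 (ltr0Sn _ _)).
rewrite cexpN_pi -polylog_double ?sub1_neq0 ?add1_neq0 //.
rewrite cexpNX -(mulr_natr (a / _)) -(mulr_natr (b / _)) !divfK ?pnatr_eq0 //.
by rewrite mulKf // expf_neq0 // pnatr_eq0.
Qed.

Lemma sum_nat_double (V : nmodType) (f : nat -> V) (n : nat) :
  \sum_(0 <= j < n + n) f j
  = \sum_(0 <= j < n) f j + \sum_(0 <= j < n) f (n + j)%N.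
Proof.
rewrite (@big_cat_nat _ _ _ n) ?leq_addr //=; congr (_ + _).
by rewrite -{1}[n]add0n big_addn addnK; apply: eq_bigr => j _; rewrite addnC.
Qed.

(** The duplication formula iterated N times. *)
Lemma polylog_mult (R : realType) (m N : nat) (a b : R) : 0 < a ->
  polylog m (cexpN a b) = ((2%:R ^+ N) ^+ m.+1)^-1 *
    \sum_(0 <= j < 2 ^ N)
      polylog m (cexpN (a / 2%:R ^+ N) ((b + pi *+ 2 * j%:R) / 2%:R ^+ N)).
Proof.
move=> a_gt0; elim: N => [|N IHN].
  by rewrite big_nat1 !expr0 expr1n invr1 mul1r mulr0 addr0 !divr1.
rewrite expnS mul2n -addnn sum_nat_double -big_split /= IHN mulr_sumr mulr_sumr.
apply: eq_bigr => j _; rewrite polylog_halve ?divr_gt0 ?exprn_gt0 ?ltr0n //.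
have div2 (x : R) : x / 2%:R ^+ N / 2%:R = x / 2%:R ^+ N.+1.
  by rewrite exprSr invfM mulrA.
rewrite (mulrA _ (2%:R ^- m.+1)) -invfM -exprMn -exprSr !div2.
congr (_ * (_ + polylog _ (cexpN _ _))).
rewrite natrD natrX exprS; field.
by rewrite expf_neq0 // pnatr_eq0.
Qed.

Lemma cexpN_2pi (R : realType) (a b : R) : cexpN a (b + pi *+ 2) = cexpN a b.
Proof. by rewrite mulr2n addrA !cexpN_pi opprK. Qed.

(** The upper half of the points is moved down by one period, so that all the
points u = (a + i(...)) / 2^(N+1) lie in the strip |Im u| <= pi when 0 <= b <=
pi. *)
Lemma polylog_mult_centred (R : realType) (m N : nat) (a b : R) : 0 < a ->
  polylog m (cexpN a b) = ((2%:R ^+ N.+1) ^+ m.+1)^-1 *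
    \sum_(0 <= j < 2 ^ N)
      (polylog m (cexpN (a / 2%:R ^+ N.+1) ((b + pi *+ 2 * j%:R) / 2%:R ^+ N.+1)) +
       polylog m (cexpN (a / 2%:R ^+ N.+1) ((b - pi *+ 2 * j.+1%:R) / 2%:R ^+ N.+1))).
Proof.
move=> a_gt0; rewrite (polylog_mult m N.+1 b a_gt0); congr (_ * _).
pose f (x : R) := polylog m (cexpN (a / 2%:R ^+ N.+1) (x / 2%:R ^+ N.+1)).
have f_per (x : R) : f (x + pi *+ 2 * 2%:R ^+ N.+1) = f x.
  have D_neq0 : 2%:R ^+ N.+1 != 0 :> R by rewrite expf_neq0 // pnatr_eq0.
  by rewrite /f mulrDl (mulfK D_neq0) cexpN_2pi.
rewrite -[LHS]/(\sum_(0 <= j < 2 ^ N.+1) f (b + pi *+ 2 * j%:R)).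
rewrite -[RHS]/(\sum_(0 <= j < 2 ^ N)
  (f (b + pi *+ 2 * j%:R) + f (b - pi *+ 2 * j.+1%:R))).
clearbody f; have: ((2 ^ N)%N%:R = 2%:R ^+ N :> R) by rewrite natrX.
rewrite expnS mul2n -addnn; move: (2 ^ N)%N => n nE.
rewrite sum_nat_double [RHS]big_split /=; apply: (f_equal2 +%R); first by [].
(* the point 2^N + (2^N - 1 - j) of the upper half is one period above -(j+1) *)
rewrite big_nat_rev /= add0n big_nat_cond [RHS]big_nat_cond.
apply: eq_bigr => j /andP[/andP[_ j_lt] _].
rewrite -[RHS]f_per; congr f.
by rewrite addnBA // natrB ?(leq_trans j_lt) ?leq_addr // natrD nE exprS; ring.
Qed.

Lemma sum_inv_sqr_le (R : realFieldType) (n : nat) :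
  \sum_(0 <= j < n) (j.+1%:R ^+ 2)^-1 <= 2%:R :> R.
Proof.
case: n => [|n]; first by rewrite big_nil.
(* the stronger bound 2 - 1/(n+1) telescopes *)
suff: \sum_(0 <= j < n.+1) (j.+1%:R ^+ 2)^-1 <= 2%:R - n.+1%:R^-1 :> R.
  by move/le_trans; apply; rewrite lerBlDr lerDl invr_ge0 ler0n.
elim: n => [|n IHn]; first by rewrite big_nat1 expr1n invr1; lra.
rewrite big_nat_recr //= (le_trans (lerD IHn (lexx _))) //.
have n1 : 0 < n.+1%:R :> R by rewrite ltr0n.
rewrite (_ : n.+2%:R = n.+1%:R + 1 :> R); last by rewrite -natr1.
move: (n.+1%:R : R) n1 => t t_gt0; have t1 : 0 < t + 1 by lra.
have : 2%:R - (t + 1)^-1 - (2%:R - t^-1 + ((t + 1) ^+ 2)^-1) = (t * (t + 1) ^+ 2)^-1.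
  by field; rewrite !gt_eqF.
have : 0 <= (t * (t + 1) ^+ 2)^-1 by rewrite invr_ge0 mulr_ge0 ?exprn_ge0 // ltW.
lra.
Qed.

Lemma complex_divC (R : realType) (x y d : R) :
  (x / d) +i* (y / d) = (x +i* y) / d%:C.
Proof.
have -> : (x +i* y) / d%:C = (x +i* y) * (d^-1)%:C by rewrite fmorphV.
by apply/eqP; rewrite eq_complex /= !mulr0 subr0 add0r (mulrC y) eqxx mulrC eqxx.
Qed.

Lemma norm_complex_ge_Im (R : realType) (x y : R) : (`|y|)%:C <= `|x +i* y|.
Proof.
rewrite normc_def lecR /= -sqrtr_sqr ler_sqrt ?addr_ge0 ?sqr_ge0 //.
by rewrite lerDr sqr_ge0.
Qed.

(** The estimate at the pole in terms of z = w + iy = D u, the point before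
division by D = 2^(N+1): after multiplication by D^(-m-1) the error is K / (D
(k+1)^2), which is summable in k and carries a vanishing factor 1/D. *)
Lemma polylog_near_pole (R : realType) (m : nat) : (1 < m)%N ->
  exists2 K : R[i], 0 <= K & forall (D w y : R) (k : nat), 0 < D -> 0 < w ->
    w / D <= 1 / 2%:R -> `|y / D| <= pi -> k.+1%:R <= `|y| ->
    `|polylog m (cexpN (w / D) (y / D)) - m`!%:R * (D%:C ^+ m.+1 / (w +i* y) ^+ m.+1)|
      <= K * D%:C ^+ m * (k.+1%:R ^+ 2)^-1.
Proof.
move=> m_gt1.
have [K K_ge0 HK] := @polylog_near1 R[i] m 3%:R 6%:R (ler0n _ _) (ler1n _ 6).
exists K => // D w y k D_gt0 w_gt0 wD yD ky; set z := w +i* y.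
have a_gt0 : 0 < w / D by rewrite divr_gt0.
have DC_neq0 : D%:C != 0 by rewrite fmorph_eq0 gt_eqF.
have z_ge : k.+1%:R <= `|z|.
  by rewrite (le_trans _ (norm_complex_ge_Im w y)) // -(rmorph_nat (real_complex R)) lecR.
have z_gt0 : 0 < `|z| by rewrite (lt_le_trans _ z_ge) // ltr0n.
have z_neq0 : z != 0 by rewrite -normr_gt0.
have s_lt1 := cexpN_lt1 (y / D) a_gt0.
have := HK (cexpN (w / D) (y / D)) (z / D%:C); rewrite -complex_divC.
have s_neq1 : cexpN (w / D) (y / D) != 1.
  by rewrite eq_sym -subr_eq0 sub1_neq0.
have u_neq0 : (w / D) +i* (y / D) != 0.
  by rewrite complex_divC mulf_neq0 ?invr_eq0.
move=> /(_ (ltW s_lt1) s_neq1 u_neq0 (cexpN_near_upper (ltW a_gt0) yD)).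
move=> /(_ (cexpN_near_lower _ yD)); rewrite (ltW a_gt0) wD => /(_ isT).
rewrite complex_divC -/z expr_div_n invf_div => /le_trans; apply.
rewrite -mulrA ler_wpM2l // normrM normfV expr_div_n invf_div.
have -> : `|D%:C| = D%:C by rewrite ger0_norm // ler0c ltW.
rewrite ler_wpM2l ?exprn_ge0 ?ler0c ?(ltW D_gt0) //.
rewrite lef_pV2 ?posrE ?exprn_gt0 ?ltr0n //.
rewrite (@le_trans _ _ (k.+1%:R ^+ m)) ?ler_weXn2l ?ler1n //.
by rewrite lerXn2r ?nnegrE ?ler0n.
Qed.

(** w + i pi/2 + 2 pi i j, the difference between w + i pi/2 and the pole -2 pi
i j; the differences with the other poles are the lower ones. *)
Definition upper_pole (R : realType) (w : R) (j : nat) : R[i] :=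
  w +i* (pi / 2%:R + pi *+ 2 * j%:R).

Definition lower_pole (R : realType) (w : R) (j : nat) : R[i] :=
  w +i* (pi / 2%:R - pi *+ 2 * j.+1%:R).

Lemma sum_inv_sqr_complex_le (R : realType) (n : nat) :
  \sum_(0 <= j < n) (j.+1%:R ^+ 2)^-1 <= 2%:R :> R[i].
Proof.
have <- : (\sum_(0 <= j < n) (j.+1%:R ^+ 2)^-1)%:C = \sum_(0 <= j < n) (j.+1%:R ^+ 2)^-1 :> R[i].
  by rewrite rmorph_sum; apply: eq_bigr => j _; rewrite fmorphV rmorphXn rmorph_nat.
by rewrite -(rmorph_nat (real_complex R)) lecR sum_inv_sqr_le.
Qed.

Lemma polylog_partial_sum (R : realType) (m : nat) (w : R) : (1 < m)%N -> 0 < w ->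
  exists2 K : R[i], 0 <= K & forall N : nat, w <= 2%:R ^+ N ->
  `|polylog m (cexpN w (pi / 2%:R)) - m`!%:R *
     \sum_(0 <= j < 2 ^ N) ((upper_pole w j ^+ m.+1)^-1 + (lower_pole w j ^+ m.+1)^-1)|
   <= K / 2%:R ^+ N.
Proof.
move=> m_gt1 w_gt0; have [K K_ge0 HK] := @polylog_near_pole R m m_gt1.
exists (2%:R * K) => [|N wN]; first by rewrite mulr_ge0.
pose D : R := 2%:R ^+ N.+1.
have D_gt0 : 0 < D by rewrite exprn_gt0.
have wD : w / D <= 1 / 2%:R.
  by rewrite ler_pdivrMr // /D exprS mulrA mul1r mulVf ?mul1r // pnatr_eq0.
have DC : D%:C = 2%:R ^+ N.+1 :> R[i] by rewrite rmorphXn rmorph_nat.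
have DC_gt0 : 0 < D%:C by rewrite ltcR.
rewrite (polylog_mult_centred m N (pi / 2%:R) w_gt0) -DC -/D.
pose A (y : R) : R[i] := polylog m (cexpN (w / D) (y / D)).
rewrite (_ : (D%:C ^+ m.+1)^-1 * _ - _ =
  (D%:C ^+ m.+1)^-1 * \sum_(0 <= j < 2 ^ N)
     ((A (pi / 2%:R + pi *+ 2 * j%:R) - m`!%:R * (D%:C ^+ m.+1 / upper_pole w j ^+ m.+1))
     + (A (pi / 2%:R - pi *+ 2 * j.+1%:R) - m`!%:R * (D%:C ^+ m.+1 / lower_pole w j ^+ m.+1)))); last first.
  rewrite !mulr_sumr -sumrB; apply: eq_bigr => j _.
  rewrite -/(A _) -/(A _); move: (A _) (A _) => A1 A2.
  move: (upper_pole w j ^+ _)^-1 (lower_pole w j ^+ _)^-1 => p q.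
  by field; rewrite expf_neq0 // gt_eqF.
rewrite normrM normfV (ger0_norm (exprn_ge0 _ (ltW DC_gt0))).
have -> : 2%:R * K / 2%:R ^+ N = (D%:C ^+ m.+1)^-1 * (K * D%:C ^+ m * (2%:R + 2%:R)).
  rewrite (exprS D%:C m) [in RHS]invfM [X in X^-1 * _ * _]DC exprS.
  by field; rewrite !expf_neq0 // ?pnatr_eq0 // gt_eqF.
rewrite ler_wpM2l ?invr_ge0 ?exprn_ge0 ?(ltW DC_gt0) //.
rewrite (le_trans (ler_norm_sum _ _ _)) // mulrDr.
apply: (@le_trans _ _ (\sum_(0 <= j < 2 ^ N)
   (K * D%:C ^+ m * (j.+1%:R ^+ 2)^-1 + K * D%:C ^+ m * (j.+1%:R ^+ 2)^-1))); last first.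
  rewrite big_split /= -mulr_sumr -!mulrDr ler_wpM2l ?lerD ?sum_inv_sqr_complex_le //.
  by rewrite mulr_ge0 ?exprn_ge0 ?(ltW DC_gt0).
rewrite big_nat_cond [leRHS]big_nat_cond; apply: ler_sum => j /andP[/andP[_ j_lt] _].
have pi2 := pi_ge2 R; have pih := pihalf_ge1 R.
have jN : j.+1%:R <= 2%:R ^+ N :> R by rewrite -natrX ler_nat.
have jpi : pi * j.+1%:R <= pi * 2%:R ^+ N :> R by rewrite ler_wpM2l // pi_ge0.
have j_ge0 : 0 <= j%:R :> R by rewrite ler0n.
have jpi2 : 2%:R * j%:R <= pi * j%:R :> R by rewrite ler_wpM2r.
rewrite -(natr1 j) mulrDr mulr1 in jpi.
rewrite (le_trans (ler_normD _ _)) // lerD //; apply: HK => //.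
- rewrite normrM normfV (ger0_norm (ltW D_gt0)) ler_pdivrMr // ger0_norm /D ?exprS; lra.
- by rewrite ger0_norm -?(natr1 j); lra.
- rewrite normrM normfV (ger0_norm (ltW D_gt0)) ler_pdivrMr // ler0_norm /D ?exprS -?(natr1 j); lra.
- rewrite ler0_norm -?(natr1 j); lra.
Qed.

(** All poles but the nearest one are at height at least 3 pi/2 times their
rank. Two factors of |w + iy| are spent on a summable 1/(k+1)^2, and the other
2n on the geometric gain. *)
Lemma norm_inv_pole_le (R : realType) (n k : nat) (w y : R) :
  3%:R * (pi / 2%:R) * k.+1%:R <= `|y| ->
  `|((w +i* y) ^+ (2 * n.+1))^-1|
    <= ((w ^+ 2 + (3%:R * (pi / 2%:R)) ^+ 2) ^- n)%:C * (k.+1%:R ^+ 2)^-1.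
Proof.
move=> y_ge; set c : R := 3%:R * (pi / 2%:R) in y_ge *.
have c_ge1 : 1 <= c by rewrite /c; have := pihalf_ge1 R; lra.
clearbody c; have c_gt0 : 0 < c by rewrite (lt_le_trans ltr01).
have c_ge0 := ltW c_gt0.
have k_ge1 : 1 <= k.+1%:R :> R by rewrite ler1n.
have yk : (c * k.+1%:R) ^+ 2 <= y ^+ 2.
  by rewrite -[y ^+ 2]real_normK ?num_real // lerXn2r ?nnegrE // mulr_ge0 ?ler0n // ltW.
have yc : c ^+ 2 <= y ^+ 2.
  have ck : c <= c * k.+1%:R by rewrite ler_peMr // ltW.
  by apply: le_trans yk; apply: lerXn2r ck; rewrite nnegrE ?mulr_ge0.
have yk1 : k.+1%:R ^+ 2 <= y ^+ 2.
  have ck : k.+1%:R <= c * k.+1%:R by rewrite ler_peMl.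
  by apply: le_trans yk; apply: lerXn2r ck; rewrite nnegrE ?mulr_ge0.
have w2 : 0 <= w ^+ 2 := sqr_ge0 w.
have r_gt0 : 0 < w ^+ 2 + c ^+ 2 by rewrite ltr_wpDl // exprn_gt0.
have -> : (k.+1%:R ^+ 2)^-1 = ((k.+1%:R ^+ 2)^-1)%:C :> R[i].
  by rewrite fmorphV rmorphXn rmorph_nat.
rewrite normfV exprM normrX normrX -add_Re2_Im2 /= -rmorphXn -fmorphV -rmorphM lecR.
rewrite -invfM lef_pV2 ?posrE ?mulr_gt0 ?exprn_gt0 ?ltr0n //; last first.
  by rewrite (lt_le_trans r_gt0) // lerD2l.
have ry : w ^+ 2 + c ^+ 2 <= w ^+ 2 + y ^+ 2 by rewrite lerD2l.
rewrite (exprSr (w ^+ 2 + y ^+ 2)); apply: ler_pM; rewrite ?exprn_ge0 ?(ltW r_gt0) ?ler0n //.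
  by rewrite lerXn2r // nnegrE addr_ge0 ?sqr_ge0.
by rewrite (le_trans yk1) // lerDr.
Qed.

Lemma two_pow_archi (R : realType) (x : R) : exists N0 : nat, forall N, (N0 <= N)%N -> x <= 2%:R ^+ N.
Proof.
exists (Num.bound `|x|) => N N0N; have := archi_boundP (normr_ge0 x).
move/(le_lt_trans (ler_norm x))/ltW/le_trans; apply.
by rewrite -natrX ler_nat (leq_trans N0N) // ltnW // ltn_expl.
Qed.

(** Letting N tend to infinity in the partial sums: apart from the nearest
pole, the two families of poles contribute at most 2 sum 1/(k+1)^2 <= 4 times
the geometric factor. *)
Lemma polylog_asymp (R : realType) (n : nat) (w : R) : (0 < n)%N -> 0 < w ->
  `|polylog (2 * n).+1 (cexpN w (pi / 2%:R)) / (2 * n).+1`!%:R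
     - ((w +i* (pi / 2%:R)) ^+ (2 * n.+1))^-1|
  <= (4%:R * (w ^+ 2 + (3%:R * (pi / 2%:R)) ^+ 2) ^- n)%:C.
Proof.
move=> n_gt0 w_gt0; set m := (2 * n).+1.
have m2 : m.+1 = (2 * n.+1)%N by rewrite /m; lia.
have m_gt1 : (1 < m)%N by rewrite /m; lia.
have [K K_ge0 HK] := polylog_partial_sum m_gt1 w_gt0.
set B := (_ * _ ^- n)%:C; set X := _ - _.
have fact_gt0C : 0 < m`!%:R :> R[i] by rewrite ltr0n fact_gt0.
pose b : R[i] := ((w ^+ 2 + (3%:R * (pi / 2%:R)) ^+ 2) ^- n)%:C.
have BE : B = b * 2%:R + b * 2%:R by rewrite /B rmorphM rmorph_nat -/b; ring.
have b_ge0 : 0 <= b by rewrite ler0c invr_ge0 exprn_ge0 // addr_ge0 ?sqr_ge0.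
have Hpole (k : nat) (y : R) : 3%:R * (pi / 2%:R) * k.+1%:R <= `|y| ->
    `|((w +i* y) ^+ m.+1)^-1| <= b * (k.+1%:R ^+ 2)^-1.
  by rewrite m2; exact: norm_inv_pole_le.
rewrite BE; clearbody b; clear B BE.
have sum_b (M : nat) : \sum_(0 <= j < M) (b * (j.+1%:R ^+ 2)^-1) <= b * 2%:R.
  by rewrite -mulr_sumr ler_wpM2l ?sum_inv_sqr_complex_le.
have pih := pihalf_ge1 R.
have pij (j : nat) : j%:R <= pi / 2%:R * j%:R :> R by rewrite ler_peMl.
have j_ge0 (j : nat) : 0 <= j%:R :> R by rewrite ler0n.
have key (N : nat) : w <= 2%:R ^+ N -> `|X| <= b * 2%:R + b * 2%:R + K / 2%:R ^+ N.
  move=> wN; have := HK N wN; have := expn_gt0 2 N; rewrite orTb.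
  move: (2 ^ N)%N => M M_gt0.
  set S := \sum_(_ <= _ < _) _ => HS.
  have S_le : `|S - ((w +i* (pi / 2%:R)) ^+ m.+1)^-1| <= b * 2%:R + b * 2%:R.
    have -> : S - ((w +i* (pi / 2%:R)) ^+ m.+1)^-1 =
      \sum_(0 <= j < M.-1) (upper_pole w j.+1 ^+ m.+1)^-1
      + \sum_(0 <= j < M) (lower_pole w j ^+ m.+1)^-1.
      rewrite /S big_split /= addrAC; congr (_ + _).
      rewrite -{1}(prednK M_gt0) big_nat_recl //= /upper_pole mulr0 addr0.
      by rewrite addrAC subrr add0r.
    rewrite (le_trans (ler_normD _ _)) //.
    rewrite lerD // (le_trans (ler_norm_sum _ _ _)) //.
      apply: le_trans (sum_b M.-1); apply: ler_sum => j _; apply: Hpole.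
      have pij1 := pij j; have j_ge01 := j_ge0 j.
      by rewrite ger0_norm -?(natr1 j); lra.
    apply: le_trans (sum_b M); apply: ler_sum => j _; apply: Hpole.
    have pij1 := pij j; have j_ge01 := j_ge0 j.
    by rewrite ler0_norm -?(natr1 j); lra.
  have -> : X = (S - ((w +i* (pi / 2%:R)) ^+ m.+1)^-1)
     + (polylog m (cexpN w (pi / 2%:R)) - m`!%:R * S) / m`!%:R.
    rewrite /X -m2; move: (_ ^+ m.+1)^-1 (polylog _ _) S {HS S_le} => p q S.
    by field; rewrite gt_eqF.
  rewrite (le_trans (ler_normD _ _)) // lerD // normrM normfV.
  rewrite (ger0_norm (ltW fact_gt0C)) ler_pdivrMr // (le_trans HS) //.
  by rewrite ler_peMr ?ler1n ?fact_gt0 // mulr_ge0 ?invr_ge0 ?exprn_ge0.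
have /complex_realP[r br] := ger0_real b_ge0.
have /complex_realP[k Kk] := ger0_real K_ge0.
have b4 : b * 2%:R + b * 2%:R = (r * 2%:R + r * 2%:R)%:C.
  by rewrite br rmorphD rmorphM rmorph_nat.
move: key; rewrite b4 normc_def lecR => key; apply/ler_addgt0Pr => e e_gt0.
have [N1 HN1] := two_pow_archi w; have [N2 HN2] := two_pow_archi (k / e).
have := key (maxn N1 N2) (HN1 _ (leq_maxl _ _)); have := HN2 _ (leq_maxr N1 N2).
move: (maxn N1 N2) => N; rewrite Kk.
have -> : k%:C / 2%:R ^+ N = (k / 2%:R ^+ N)%:C.
  by rewrite rmorphM fmorphV rmorphXn rmorph_nat.
rewrite -rmorphD lecR => KN /le_trans; apply; rewrite lerD2l.
by rewrite ler_pdivrMr ?exprn_gt0 // mulrC -ler_pdivrMr.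
Qed.

(** * Sign of Xi along the alternation angles *)

Lemma map_polylog_num (A B : comNzRingType) (f : {rmorphism A -> B}) (m : nat) :
  map_poly f (polylog_num A m) = polylog_num B m.
Proof.
elim: m => [|m IHm] /=; first by rewrite map_polyX.
by rewrite !rmorphM rmorphD !rmorphM rmorphB rmorph1 rmorph_nat /= map_polyX -deriv_map IHm.
Qed.

Lemma rmorph_polylog (F K : fieldType) (f : {rmorphism F -> K}) (m : nat) (s : F) :
  f (polylog m s) = polylog m (f s).
Proof.
rewrite /polylog rmorphM fmorphV rmorphXn rmorphB rmorph1 /=.
by rewrite -horner_map map_polylog_num.
Qed.

(** For s = exp(-(w + i pi/2)) = -i exp(-w), the opposite -s is the conjugate
of s, so the odd part of L_m is i times its imaginary part. *)
Lemma desB_polylog_Im (R : realType) (m : nat) (w : R) : 0 < w ->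
  let q := expR (- (w *+ 2)) in
  complex.Im (polylog m (cexpN w (pi / 2%:R)))
  = - (expR (- w) * (desB_poly R m).[- q] / (1 + q) ^+ m.+1).
Proof.
move=> w_gt0 q; set s := cexpN w (pi / 2%:R).
have s_lt1 : `|s| < 1 by apply: cexpN_lt1.
have q_gt0 : 0 < q by apply: expR_gt0.
have sE : s = (- expR (- w))%:C * 'i.
  by rewrite /s /cexpN cos_pihalf sin_pihalf mulr0 mulr1; apply/eqP;
     rewrite eq_complex /= !mulr0 !mul0r mulr1 subrr addr0 !eqxx.
have s2 : s ^+ 2 = (- q)%:C.
  have -> : q = expR (- w) ^+ 2 by rewrite -expRM_natl /q -(mulr_natl w) mulrN.
  by rewrite sE exprMn sqr_i -rmorphXn sqrrN mulrN1 rmorphN.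
have Ns : - s = conjc s.
  by rewrite /s /cexpN cos_pihalf mulr0; apply/eqP; rewrite eq_complex /= oppr0 !eqxx.
have := @desB_poly_polylog_eval R[i] m s (sub1_neq0 s_lt1) (add1_neq0 s_lt1).
rewrite Ns -rmorph_polylog subcJ /= s2.
have -> : (desB_poly R[i] m).[(- q)%:C] = ((desB_poly R m).[- q])%:C.
  rewrite !horner_sum rmorph_sum; apply: eq_bigr => u _.
  by rewrite !hornerXn rmorphXn.
have -> : 1 - (- q)%:C = (1 + q)%:C by rewrite rmorphN opprK rmorphD rmorph1.
rewrite -rmorphXn sE -fmorphV.
set B := (_).[_]; set D := (_ ^+ _)^-1; set t := complex.Im _ => eq_t.
have : 2%:R * (- expR (- w) * B * D)%:C * 'i = 2%:R * t%:C * 'i.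
  by rewrite -eq_t !rmorphM; ring.
have i_neq0 : 'i != 0 :> R[i] by rewrite eq_complex /= oner_eq0 andbF.
move/(mulIf i_neq0)/mulfI; rewrite pnatr_eq0 => /(_ isT) /complexI <-.
by rewrite !mulNr.
Qed.

Lemma bernoulli_ineq (R : realFieldType) (x : R) (n : nat) : 0 <= x ->
  1 + n%:R * x <= (1 + x) ^+ n.
Proof.
move=> x_ge0; elim: n => [|n IHn]; first by rewrite mul0r addr0 expr0.
rewrite exprS (le_trans _ (ler_wpM2l _ IHn)) ?addr_ge0 // -natr1.
have : 0 <= n%:R * x * x by rewrite !mulr_ge0.
lra.
Qed.

(** For w = (pi/2) cot t, the point w + i pi/2 has argument t and modulus pi /
(2 sin t). *)
Lemma pole_polar (R : realType) (n : nat) (t : R) : 0 < sin t ->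
  complex.Im ((((pi / 2%:R * (cos t / sin t)) +i* (pi / 2%:R)) ^+ n)^-1)
  = - ((2%:R * sin t / pi) ^+ n * sin (n%:R * t)).
Proof.
move=> sin_gt0; set z := _ +i* _; set r := 2%:R * sin t / pi.
have pi0 : pi != 0 :> R by rewrite gt_eqF ?pi_gt0.
have s0 : sin t != 0 by rewrite gt_eqF.
have zr : z * (r%:C * cexpN 0 t) = 1.
  rewrite /z /r /cexpN oppr0 expR0 !mul1r; apply/eqP; rewrite eq_complex /=.
  rewrite !(mul0r, subr0, addr0, add0r) /=.
  move: (pi : R) pi0 => p p0; apply/andP; split; apply/eqP.
    transitivity (cos t ^+ 2 + sin t ^+ 2); last exact: cos2Dsin2.
    by field; rewrite p0 s0.
  by field; rewrite p0 s0.
have z0 : z != 0 by apply: contra_eq_neq zr => ->; rewrite mul0r eq_sym oner_eq0.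
have -> : (z ^+ n)^-1 = (r%:C * cexpN 0 t) ^+ n.
  by rewrite -exprVn; congr (_ ^+ n); apply: (mulfI z0); rewrite zr mulfV.
rewrite exprMn -rmorphXn cexpNX mul0rn -(mulr_natl t) /cexpN oppr0 expR0 !mul1r /=.
by rewrite mul0r addr0 mulrN.
Qed.

(** With r = 1/|w + i pi/2|, the nearest pole contributes r^(2n+2) in absolute
value at an angle where |sin((2n+2)t)| = 1, and the others at most 4 (r^(-2) +
2 pi^2)^(-n). As (1 + 2 pi^2 r^2)^n >= 1 + 8 n r^2, the former wins once 8 n
d^4 > 4, where d bounds r from below. *)
Lemma desB_poly_sign (R : realType) (n : nat) (d t : R) :
  0 < d -> 1 < 2%:R * n%:R * d ^+ 4 -> 0 < sin t -> 0 < cos t ->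
  d <= 2%:R * sin t / pi -> sin ((2 * n.+1)%:R * t) ^+ 2 = 1 ->
  0 < sin ((2 * n.+1)%:R * t) *
      (desB_poly R (2 * n).+1).[- expR (- ((pi / 2%:R * (cos t / sin t)) *+ 2))].
Proof.
move=> d_gt0 nd sin_gt0 cos_gt0 d_le sin2; set w := pi / _ * _.
have w_gt0 : 0 < w by rewrite !mulr_gt0 ?invr_gt0 ?pi_gt0.
have n_gt0 : (0 < n)%N.
  by case: n nd {sin2} => // ; rewrite mulr0 mul0r; rewrite ltNge ler01.
have := polylog_asymp n_gt0 w_gt0.
set r := 2%:R * sin t / pi in d_le; set m := (2 * n).+1.
set P := polylog _ _; set Z := (_ ^+ _)^-1 => HPZ.
have ImZ : complex.Im Z = - (r ^+ (2 * n.+1) * sin ((2 * n.+1)%:R * t)) by apply: pole_polar.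
have ImP := @desB_polylog_Im R m w w_gt0.
have fact_gt0 : 0 < m`!%:R :> R by rewrite ltr0n fact_gt0.
have ImPm : complex.Im (P / m`!%:R) = complex.Im P / m`!%:R.
  by rewrite -(rmorph_nat (real_complex R)) -fmorphV; case: (P) => a b; rewrite /= mulr0 add0r.
have rho : (pi / 2%:R * (cos t / sin t)) ^+ 2 + (3%:R * (pi / 2%:R)) ^+ 2
    = (r ^+ 2)^-1 + 2%:R * pi ^+ 2.
  have := cos2Dsin2 t; rewrite /r; have := pi_gt0 R; move: (pi : R) => p p_gt0.
  have s0 := lt0r_neq0 sin_gt0; have p0 := lt0r_neq0 p_gt0.
  move=> cs; transitivity ((cos t ^+ 2 + sin t ^+ 2) * p ^+ 2 / (4%:R * sin t ^+ 2) + 2%:R * p ^+ 2).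
    by field.
  by rewrite cs; field; rewrite p0 s0.
(* the squared distance to the next pole, in terms of r: w^2 + (pi/2)^2 = r^(-2) *)
rewrite -/w in rho; rewrite rho in HPZ.
have r_gt0 : 0 < r by rewrite (lt_le_trans d_gt0).
have main : 4%:R * ((r ^+ 2)^-1 + 2%:R * pi ^+ 2) ^- n < r ^+ (2 * n.+1).
  have pi2 : 4%:R <= pi ^+ 2 :> R.
    by have := pi_ge2 R => h; rewrite (_ : 4%:R = 2%:R ^+ 2) ?lerXn2r ?nnegrE ?pi_ge0 //; ring.
  have r2_gt0 : 0 < r ^+ 2 by rewrite exprn_gt0.
  have D_gt0 : 0 < (r ^+ 2)^-1 + 2%:R * pi ^+ 2.
    by rewrite addr_gt0 ?invr_gt0 // mulr_gt0 // exprn_gt0 ?pi_gt0.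
  rewrite ltr_pdivrMr ?exprn_gt0 // exprM exprS -mulrA -exprMn mulrDr mulfV ?lt0r_neq0 //.
  have d2 : d ^+ 2 <= r ^+ 2 by rewrite lerXn2r // nnegrE ltW.
  have d4 : d ^+ 4 <= r ^+ 2 * r ^+ 2.
    by rewrite (_ : d ^+ 4 = d ^+ 2 * d ^+ 2) ?ler_pM ?exprn_ge0 ?(ltW d_gt0) // -exprD.
  have x_ge0 : 0 <= r ^+ 2 * (2%:R * pi ^+ 2).
    by rewrite mulr_ge0 ?(ltW r2_gt0) // mulr_ge0 // sqr_ge0.
  have bern := bernoulli_ineq n x_ge0.
  apply: lt_le_trans (ler_wpM2l (ltW r2_gt0) bern).
  have x8 : r ^+ 2 * (r ^+ 2 * 8%:R) <= r ^+ 2 * (r ^+ 2 * (2%:R * pi ^+ 2)).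
    by rewrite !ler_wpM2l ?(ltW r2_gt0) //; lra.
  have n8 := ler_wpM2l (ler0n R n) x8.
  have n4 := ler_wpM2l (ler0n R n) d4.
  lra.
have HIm : `|complex.Im (P / m`!%:R - Z)| < r ^+ (2 * n.+1).
  apply: le_lt_trans main; rewrite -lecR; apply: le_trans HPZ.
  by case: (P / m`!%:R - Z) => x y; exact: norm_complex_ge_Im.
move: HIm; rewrite raddfB /= ImPm ImP ImZ /=.
set s := sin _ in sin2 *; set B := (_).[_]; set ew := expR (- w).
have ew_gt0 : 0 < ew by apply: expR_gt0.
set D := (_ ^+ m.+1); have D_gt0 : 0 < D by rewrite exprn_gt0 // addr_gt0 // expR_gt0.
have -> : ew * B / D = B * (ew / D) by ring.
have c_gt0 : 0 < ew / D / m`!%:R by rewrite !divr_gt0.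
rewrite -mulNr -!mulrA [ew * _]mulrA; move: (ew / D / m`!%:R) c_gt0 => c c_gt0.
rewrite opprK; move: (r ^+ _) => x.
move/eqP: sin2; rewrite sqrf_eq1 => /orP[] /eqP ->.
  by rewrite ltr_norml mul1r -(pmulr_lgt0 _ c_gt0) => /andP[_ h]; lra.
by rewrite ltr_norml mulN1r -(pmulr_lgt0 _ c_gt0) => /andP[h _]; lra.
Qed.

(** For positive y, the factor of B_m in Xi_(n+1)(y) has the sign (-1)^n, and y
= (1-q)/(1+q) is equivalent to q = (1-y)/(1+y). *)
Lemma Xi_sign (R : realType) (n : nat) (d t : R) :
  0 < d -> 1 < 2%:R * n%:R * d ^+ 4 -> 0 < sin t -> 0 < cos t ->
  d <= 2%:R * sin t / pi -> sin ((2 * n.+1)%:R * t) ^+ 2 = 1 ->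
  forall q, q = expR (- ((pi / 2%:R * (cos t / sin t)) *+ 2)) ->
  0 < (-1) ^+ n * sin ((2 * n.+1)%:R * t) * Xi n.+1 ((1 - q) / (1 + q)).
Proof.
move=> d_gt0 nd sin_gt0 cos_gt0 d_le sin2 q qE.
have := desB_poly_sign d_gt0 nd sin_gt0 cos_gt0 d_le sin2; rewrite -qE.
have q_gt0 : 0 < q by rewrite qE expR_gt0.
have q_lt1 : q < 1.
  by rewrite qE expR_lt1 oppr_lt0 mulrn_wgt0 // !mulr_gt0 ?invr_gt0 ?pi_gt0.
set y := (1 - q) / (1 + q).
have y_gt0 : 0 < y by rewrite divr_gt0 //; lra.
have q1 : 1 + q != 0 by rewrite gt_eqF //; lra.
have yq : (1 - y) / (1 + y) = q.
  by rewrite /y; field; rewrite q1 /=; apply: lt0r_neq0; lra.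
rewrite /Xi yq eulerianB_polyE.
rewrite (_ : (2 * n.+1 - 1 = (2 * n).+1)%N); last lia.
set s := sin _; set B := (_).[_]; set E1 := _ * _%:R; set E2 := _ / y => sB.
have E1_gt0 : 0 < E1 by rewrite mulr_gt0 ?exprn_gt0 ?ltr0n ?fact_gt0.
have E2_gt0 : 0 < E2 by rewrite divr_gt0 // exprn_gt0 // addr_gt0.
have -> : (-1) ^+ n * s * ((-1) ^+ n.+2 / E1 * E2 * B) = ((-1) ^+ n) ^+ 2 * (E2 / E1) * (s * B).
  by rewrite !exprS; ring.
by rewrite sqrr_sign mul1r mulr_gt0 // divr_gt0.
Qed.

(** * Quantiles of the limit law and alternation of Xi_tilde *)

Lemma F_limit_ge0 (R : realType) (x : R) : 0 <= F_limit x.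
Proof.
rewrite /F_limit; case: (leP x 0) => // x_gt0; case: (ltP x 1) => // x_lt1.
have s_ge0 := sqrtr_ge0 x; have s_lt1 : Num.sqrt x < 1 by rewrite -sqrtr1 ltr_sqrt.
rewrite mulr_ge0 ?divr_ge0 ?pi_ge0 // -(@atan0 R) le_atan //.
rewrite mulr_ge0 ?divr_ge0 ?pi_ge0 // ln_ge0 // ler_pdivlMr; lra.
Qed.

Lemma F_limit_le1 (R : realType) (x : R) : F_limit x <= 1.
Proof.
rewrite /F_limit; case: (leP x 0) => // x_gt0; case: (ltP x 1) => // x_lt1.
rewrite [leRHS](_ : 1 = 2%:R / pi * (pi / 2%:R)); last first.
  by have := pi_gt0 R; move: (pi : R) => p /lt0r_neq0 p0; field.
by rewrite ler_wpM2l ?divr_ge0 ?pi_ge0 // ltW // atan_ltpi2.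
Qed.

Lemma F_limit_nondecreasing (R : realType) (x y : R) :
  x <= y -> F_limit x <= F_limit y.
Proof.
move=> xy; have := F_limit_ge0 y; have := F_limit_le1 x; rewrite /F_limit.
have [//|x_gt0] := leP x 0; have y_gt0 := lt_le_trans x_gt0 xy.
rewrite [y <= 0]leNgt y_gt0 /=.
have [y_lt1|//] := ltP y 1; have x_lt1 := le_lt_trans xy y_lt1.
rewrite x_lt1 => _ _.
rewrite ler_wpM2l ?divr_ge0 ?pi_ge0 // le_atan // ler_wpM2l ?divr_ge0 ?pi_ge0 //.
have sx_ge0 := sqrtr_ge0 x; have sy_lt1 : Num.sqrt y < 1 by rewrite -sqrtr1 ltr_sqrt.
have sxy : Num.sqrt x <= Num.sqrt y by rewrite ler_sqrt // ltW.
move: (Num.sqrt x) (Num.sqrt y) sx_ge0 sy_lt1 sxy => a b a_ge0 b_lt1 ab.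
have a1 : 0 < 1 - a by lra.
have b1 : 0 < 1 - b by lra.
rewrite ler_ln ?posrE ?divr_gt0 //; try lra.
rewrite ler_pdivrMr // mulrAC ler_pdivlMr //.
by have := ler_wpM2r (ltW b1) ab; lra.
Qed.

(** The angles at which sin(2n t) = (-1)^j. *)
Definition node_angle (R : realType) (n j : nat) : R :=
  (2 * j).+1%:R * pi / (4 * n)%:R.

Definition node_exp (R : realType) (n j : nat) : R :=
  let t := node_angle R n j in expR (- ((pi / 2%:R * (cos t / sin t)) *+ 2)).

(** tanh(w)^2 for w = (pi/2) cot t, t the alternation angle: node_exp is
exp(-2w). *)
Definition node (R : realType) (n j : nat) : R :=
  ((1 - node_exp R n j) / (1 + node_exp R n j)) ^+ 2.

Lemma node_angle_itv (R : realType) (n j : nat) : (j < n)%N ->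
  0 < node_angle R n j < pi / 2%:R.
Proof.
move=> jn; have n_gt0 : 0 < (4 * n)%:R :> R by rewrite ltr0n; lia.
rewrite /node_angle divr_gt0 ?mulr_gt0 ?pi_gt0 ?ltr0Sn //=.
rewrite ltr_pdivrMr // mulrC -(mulrA pi) ltr_pM2l ?pi_gt0 //.
by rewrite ltr_pdivlMl // -natrM ltr_nat; lia.
Qed.

Lemma sin_node_angle_gt0 (R : realType) (n j : nat) : (j < n)%N ->
  0 < sin (node_angle R n j).
Proof. by move=> /(node_angle_itv R) h; apply: sin_gt0_pihalf. Qed.

Lemma cos_node_angle_gt0 (R : realType) (n j : nat) : (j < n)%N ->
  0 < cos (node_angle R n j).
Proof.
move=> /(node_angle_itv R) /andP[h1 h2]; apply: cos_gt0_pihalf; rewrite h2 andbT.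
by rewrite (lt_trans _ h1) // oppr_lt0 divr_gt0 ?pi_gt0.
Qed.

Lemma node_exp_itv (R : realType) (n j : nat) : (j < n)%N ->
  0 < node_exp R n j < 1.
Proof.
move=> jn; rewrite expR_gt0 expR_lt1 oppr_lt0 mulrn_wgt0 //=.
by rewrite !mulr_gt0 ?invr_gt0 ?pi_gt0 ?cos_node_angle_gt0 ?sin_node_angle_gt0.
Qed.

(** At x = tanh(w)^2 the logarithm is 2w, and arctan(2w/pi) = arctan(cot t) =
pi/2 - t. So F is affine in the angle, and the nodes are equidistributed for F.
*)
Lemma F_limit_node (R : realType) (n j : nat) : (j < n)%N ->
  F_limit (node R n j) = 1 - (2 * j).+1%:R / (2 * n)%:R.
Proof.
move=> jn; have /andP[q_gt0 q_lt1] := node_exp_itv R jn.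
have /andP[t_gt0 t_lt] := node_angle_itv R jn.
have s_gt0 := sin_node_angle_gt0 R jn; have c_gt0 := cos_node_angle_gt0 R jn.
have : node_exp R n j = expR (- ((pi / 2%:R * (cos (node_angle R n j) / sin (node_angle R n j))) *+ 2)) by [].
rewrite /node; move: (node_exp R n j) q_gt0 q_lt1 => q q_gt0 q_lt1 qE.
set y := (1 - q) / (1 + q).
have q1 : 0 < 1 + q by lra.
have y_gt0 : 0 < y by rewrite divr_gt0 //; lra.
have y_lt1 : y < 1 by rewrite ltr_pdivrMr //; lra.
rewrite /F_limit leNgt exprn_gt0 //= exprn_ilt1 ?(ltW y_gt0) //.
rewrite sqrtr_sqr gtr0_norm //.
have -> : (1 + y) / (1 - y) = q^-1.
  rewrite /y; field; rewrite !lt0r_neq0 //=; lra.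
rewrite qE -expRN opprK expRK.
set t := node_angle R n j in t_gt0 t_lt s_gt0 c_gt0 *.
have -> : 1 / pi * ((pi / 2%:R * (cos t / sin t)) *+ 2) = cos t / sin t.
  by have := pi_gt0 R; move: (pi : R) => p /lt0r_neq0 p0; field; rewrite p0 lt0r_neq0.
have <- : tan (pi / 2%:R - t) = cos t / sin t.
  by rewrite /tan sinB cosB sin_pihalf cos_pihalf !mul1r !mul0r subr0 add0r.
rewrite tanK ?in_itv /=; last by apply/andP; split; lra.
rewrite /t /node_angle !natrM.
have n0 : n%:R != 0 :> R by rewrite pnatr_eq0 -lt0n (leq_trans _ jn).
by have := pi_gt0 R; move: (pi : R) => p /lt0r_neq0 p0; field; rewrite p0 n0.
Qed.

Lemma node_lt (R : realType) (n i j : nat) : (i < j)%N -> (j < n)%N ->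
  node R n j < node R n i.
Proof.
move=> ij jn; have n_gt0 : 0 < (2 * n)%:R :> R by rewrite ltr0n; lia.
rewrite ltNge; apply/negP => /F_limit_nondecreasing.
rewrite !F_limit_node // ?(ltn_trans ij) // lerD2l lerN2 ler_pM2r ?invr_gt0 // ler_nat; lia.
Qed.

Lemma sin_odd_pihalf (R : realType) (j : nat) :
  sin ((2 * j).+1%:R * (pi / 2%:R)) = (-1) ^+ j :> R.
Proof.
have -> : (2 * j).+1%:R * (pi / 2%:R) = pi / 2%:R + pi *+ j :> R.
  by rewrite -natr1 natrM -(mulr_natl pi); field.
by rewrite (alternatingn (@sinDpi R)) sin_pihalf mulr1.
Qed.

(** At angles t_j with j >= c n the distance to the nearest pole is bounded
independently of n, which makes the domination by that pole uniform in j. *)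
Lemma Xi_tilde_node_sign (R : realType) (c : R) : 0 < c ->
  exists N : nat, forall n j : nat, (N <= n)%N -> c * n%:R <= j%:R -> (j < n)%N ->
    0 < (-1) ^+ (n + j) * - (Xi_tilde R n).[node R n j].
Proof.
move=> c_gt0; pose d := c / 4%:R; have d_gt0 : 0 < d by rewrite divr_gt0.
(* n >= d^(-4) is enough for the condition 2 n d^4 > 1 of the sign lemma *)
exists (Num.bound (d ^- 4)).+2 => -[//|n] j Nn cn jn.
have d4_gt0 : 0 < d ^+ 4 by rewrite exprn_gt0.
have nd : 1 < 2%:R * n%:R * d ^+ 4.
  have := archi_boundP (ltW (_ : 0 < d ^- 4)); rewrite invr_gt0 => /(_ d4_gt0).
  move: Nn; rewrite ltnS => Nn /lt_le_trans /(_ (_ : _ <= n%:R)).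
  rewrite ler_nat => /(_ (ltnW Nn)); rewrite -div1r ltr_pdivrMr // => h.
  have : 0 <= n%:R * d ^+ 4 by rewrite mulr_ge0 // ltW.
  lra.
have /andP[t_gt0 t_lt] := node_angle_itv R jn.
have s_gt0 := sin_node_angle_gt0 R jn; have c0_gt0 := cos_node_angle_gt0 R jn.
have /andP[q_gt0 q_lt1] := node_exp_itv R jn.
have d_le : d <= 2%:R * sin (node_angle R n.+1 j) / pi.
  have t2 : 0 <= node_angle R n.+1 j <= 2%:R.
    by rewrite ltW //= (le_trans (ltW t_lt)) // ltW // pihalf_lt2.
  have := sin_ge_quarter t2; rewrite ler_pdivlMr ?pi_gt0 // => h.
  suff : d * pi <= node_angle R n.+1 j / 2%:R by lra.
  rewrite /node_angle /d; have n0 : 0 < n.+1%:R :> R by rewrite ltr0n.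
  have cj : c <= j%:R / n.+1%:R by rewrite ler_pdivlMr.
  rewrite (_ : _ / _ / _ = pi * ((j%:R / n.+1%:R) / 4%:R + (n.+1%:R)^-1 / 8%:R)).
    rewrite mulrC ler_pM2l ?pi_gt0 //.
    have : 0 < (n.+1%:R)^-1 :> R by rewrite invr_gt0.
    by move: cj; move: (j%:R / _) => u; move: (n.+1%:R^-1) => v; lra.
  rewrite -natr1 !natrM; move: (pi : R) => p; field; rewrite lt0r_neq0 //.
have angE : (2 * n.+1)%:R * node_angle R n.+1 j = (2 * j).+1%:R * (pi / 2%:R).
  have n0 : 0 < n.+1%:R :> R by rewrite ltr0n.
  by rewrite /node_angle !natrM; move: (pi : R) => p; field; rewrite lt0r_neq0.
have sinE : sin ((2 * n.+1)%:R * node_angle R n.+1 j) = (-1) ^+ j.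
  by rewrite angE sin_odd_pihalf.
have sin2 : sin ((2 * n.+1)%:R * node_angle R n.+1 j) ^+ 2 = 1.
  by rewrite sinE sqrr_sign.
have := Xi_sign d_gt0 nd s_gt0 c0_gt0 d_le sin2 (erefl _).
rewrite -/(node_exp R n.+1 j) sinE -exprD.
have y_gt0 : 0 < (1 - node_exp R n.+1 j) / (1 + node_exp R n.+1 j).
  by rewrite divr_gt0; lra.
have [_ ->] := Xi_tilde_poly R (ltn0Sn n); last by rewrite exprn_gt0.
by rewrite sqrtr_sqr gtr0_norm // addSn exprS mulN1r mulrNN.
Qed.

Lemma Xi_tilde_zero (R : realType) (c : R) : 0 < c ->
  exists N : nat, forall n : nat, (N <= n)%N -> forall j : nat,
    c * n%:R <= j%:R -> (j.+1 < n)%N ->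
    Xi_tilde R n != 0 /\
    exists2 z : R, node R n j.+1 < z < node R n j & root (Xi_tilde R n) z.
Proof.
move=> c_gt0; have [N HN] := Xi_tilde_node_sign c_gt0; exists N => n Nn j cj jn.
have s0 := HN n j Nn cj (ltnW jn).
have s1 : 0 < (-1) ^+ (n + j.+1) * - (Xi_tilde R n).[node R n j.+1].
  by apply: HN => //; rewrite (le_trans cj) // ler_nat.
split; first by apply: contraTneq s0 => ->; rewrite horner0 oppr0 mulr0 ltxx.
have lt_nodes : node R n j.+1 < node R n j by apply: node_lt.
(* the signs at consecutive nodes are opposite *)
have [|z] := @poly_ivtoo _ (Xi_tilde R n) _ _ (ltW lt_nodes).
  move: s0 s1; rewrite addnS exprS -signr_odd.
  move: (_.[_]) (_.[_]) => a b.
  case: (odd _); rewrite ?expr0 ?expr1 => s0 s1; [rewrite pmulr_llt0|rewrite nmulr_llt0]; lra.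
by rewrite in_itv; exists z.
Qed.

(** * Counting zeros *)

(** The counting function includes the default value 0 at the indices beyond
the end of the list of real zeros. *)
Lemma F_zerosE (R : realType) (n : nat) (x : R) :
  F_zeros n x
  = n.-1%:R^-1 * (count (fun k => zero_Xi R n k <= x) (iota 0 n.-1))%:R.
Proof.
rewrite /F_zeros /mu_zeros /mscale /= /msum.
have -> : (\sum_(k < n.-1) \d_(zero_Xi R n k) `]-oo, x] =
   ((count (fun k => zero_Xi R n k <= x) (iota 0 n.-1))%:R : R)%:E)%E.
  rewrite -(big_mkord xpredT (fun k => \d_(zero_Xi R n k) `]-oo, x])%E).
  rewrite /index_iota subn0 -sum1_count natr_sum [in RHS]big_mkcond -sumEFin.
  apply: eq_bigr => k _; rewrite diracE mem_setE in_itv /=.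
  by case: (_ <= _).
by rewrite -EFinM.
Qed.

Lemma count_nth_ge (T : Type) (d : T) (P : pred T) (s : seq T) (N : nat) :
  (size s <= N)%N ->
  (count P s <= count (fun k => P (nth d s k)) (iota 0 N))%N.
Proof.
move=> sN; by rewrite -{1}(mkseq_nth d s) count_map -(subnKC sN) iotaD count_cat leq_addr.
Qed.

(** The zeros found between consecutive nodes are distinct, so a property
shared by all points of b - a consecutive gaps holds for at least b - a zeros.
*)
Lemma count_zeros_ge (R : realType) (c : R) : 0 < c ->
  exists N : nat, forall (n a b : nat) (P : pred R), (N <= n)%N ->
    c * n%:R <= a%:R -> (b < n)%N ->
    (forall j z, (a <= j < b)%N -> node R n j.+1 < z < node R n j -> P z) ->
    (b - a <= count P (real_zeros (Xi_tilde R n)))%N.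
Proof.
move=> c_gt0; have [N HN] := Xi_tilde_zero c_gt0; exists N => n a b P Nn ca bn HP.
case: (leqP b a) => [|ab]; first by rewrite -subn_eq0 => /eqP ->.
have Hj j : (a <= j < b)%N -> Xi_tilde R n != 0 /\
    exists2 z : R, node R n j.+1 < z < node R n j & root (Xi_tilde R n) z.
  move=> /andP[aj jb]; apply: HN => //; last exact: leq_ltn_trans bn.
  by rewrite (le_trans ca) // ler_nat.
have /choice[f Hf] : forall j, exists z : R, (a <= j < b)%N ->
    node R n j.+1 < z < node R n j /\ root (Xi_tilde R n) z.
  move=> j; case: (boolP (a <= j < b)%N) => [/Hj[_ [z z1 z2]]|_]; first by exists z.
  by exists 0.
have Xi_neq0 : Xi_tilde R n != 0 by have [] := Hj a; rewrite ?leqnn.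
have f_lt i j : (a <= i < b)%N -> (a <= j < b)%N -> (i < j)%N -> f j < f i.
  move=> iab jab ij; have [/andP[_ fj] _] := Hf j jab; have [/andP[fi _] _] := Hf i iab.
  apply: (lt_le_trans fj); apply: (le_trans _ (ltW fi)).
  move: ij; rewrite leq_eqVlt => /predU1P[->//|ij]; apply/ltW/node_lt => //.
  by case/andP: jab => _ /ltn_trans; apply.
have mem_iota_ab j : (j \in iota a (b - a)) = (a <= j < b)%N by rewrite mem_iota subnKC // ltnW.
rewrite -(size_iota a (b - a)) -(size_map f) -size_filter; apply: uniq_leq_size.
  rewrite map_inj_in_uniq ?iota_uniq // => i j; rewrite !mem_iota_ab => iab jab fij.
  case: (ltngtP i j) => // ij; first by have := f_lt i j iab jab ij; rewrite fij ltxx.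
  by have := f_lt j i jab iab ij; rewrite fij ltxx.
move=> _ /mapP[j jab ->]; rewrite mem_iota_ab in jab; have [fj1 fj2] := Hf j jab.
by rewrite mem_filter (HP j) //= mem_real_zeros.
Qed.

(** Monotonicity of F turns the comparison of x with a node into one between j
and n (1 - F(x)). *)
Lemma F_limit_node_lt (R : realType) (n j : nat) (x : R) : (j < n)%N ->
  n%:R * (1 - F_limit x) <= j%:R -> node R n j <= x.
Proof.
move=> jn xj; have n_gt0 : 0 < n%:R :> R by rewrite ltr0n (leq_trans _ jn).
rewrite leNgt; apply/negP => /ltW/F_limit_nondecreasing; rewrite F_limit_node //.
have -> : (2 * j).+1%:R / (2 * n)%:R = (j%:R + 1 / 2%:R) / n%:R :> R.
  by rewrite -natr1 !natrM; field; rewrite lt0r_neq0.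
rewrite lerBrDr -lerBrDl ler_pdivrMr //; lra.
Qed.

Lemma F_limit_node_gt (R : realType) (n j : nat) (x : R) : (j < n)%N ->
  j.+1%:R <= n%:R * (1 - F_limit x) -> x <= node R n j.
Proof.
move=> jn xj; have n_gt0 : 0 < n%:R :> R by rewrite ltr0n (leq_trans _ jn).
rewrite leNgt; apply/negP => /ltW/F_limit_nondecreasing; rewrite F_limit_node //.
have -> : (2 * j).+1%:R / (2 * n)%:R = (j%:R + 1 / 2%:R) / n%:R :> R.
  by rewrite -natr1 !natrM; field; rewrite lt0r_neq0.
rewrite lerBlDr -lerBlDl ler_pdivlMr //; rewrite -(natr1 j) in xj; lra.
Qed.

(** Lower bound: the gaps of index j >= n (1 - F(x)) lie below x. Upper bound:
the gaps of index j + 2 <= n (1 - F(x)) lie above x, and there are at most n -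
1 zeros in all. In both cases the gaps of index j < c n are given up. *)
Lemma count_zeros_close (R : realType) (c : R) : 0 < c ->
  exists N : nat, forall (n : nat) (x : R), (N <= n)%N -> (1 < n)%N ->
    `|(count (fun k => zero_Xi R n k <= x) (iota 0 n.-1))%:R - n%:R * F_limit x|
      <= c * n%:R + 3%:R.
Proof.
move=> c_gt0; have [N HN] := count_zeros_ge c_gt0; exists N => n x Nn n_gt1.
have n_gt0 : (0 < n)%N by rewrite ltnW.
have n1 : n%:R = n.-1%:R + 1 :> R by rewrite natr1 prednK.
have F_ge0 := F_limit_ge0 x; have F_le1 := F_limit_le1 x.
set C := count _ _; set Z := real_zeros (Xi_tilde R n).
have sZ : (size Z <= n.-1)%N.
  apply: leq_trans (size_real_zeros _) _; have [s _] := Xi_tilde_poly R n_gt0.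
  by rewrite -!subn1 leq_sub2r.
have lowC : (count (fun z => z <= x)%R Z <= C)%N by apply: count_nth_ge.
have upC : (count (fun z => ~~ (z <= x)%R) Z <= n.-1 - C)%N.
  apply: leq_trans (count_nth_ge 0 _ sZ) _.
  by rewrite -{2}(size_iota 0 n.-1) -(count_predC (fun k => zero_Xi R n k <= x)) addKn.
have cn_ge0 : 0 <= c * n%:R by rewrite mulr_ge0 // ltW.
have nF_ge0 : 0 <= n%:R * (1 - F_limit x) by rewrite mulr_ge0 // subr_ge0.
have C_le : (C <= n.-1)%N by rewrite (leq_trans (count_size _ _)) ?size_iota.
have ub : C%:R <= n%:R * F_limit x + c * n%:R + 3%:R.
  pose a := (Num.truncn (c * n%:R)).+1.
  pose T := Num.truncn (n%:R * (1 - F_limit x)).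
  have /andP[a1 _] := truncn_itv cn_ge0; have /andP[T1 T2] := truncn_itv nF_ge0.
  have ha : c * n%:R <= a%:R by rewrite ltW // truncnS_gt.
  have T_le : (T <= n)%N.
    by rewrite -(ler_nat R) (le_trans T1) // ler_piMr //; lra.
  have b_lt : (T.-1 < n)%N by move: (T) T_le => [|t].
  have HP j z : (a <= j < T.-1)%N -> node R n j.+1 < z < node R n j -> ~~ (z <= x).
    move=> /andP[_ jT] /andP[z1 _]; rewrite -ltNge (le_lt_trans _ z1) //.
    have jT2 : (j.+2 <= T)%N by rewrite -ltn_predRL.
    apply: F_limit_node_gt; first exact: leq_trans jT2 T_le.
    by rewrite (le_trans _ T1) // ler_nat.
  have := leq_trans (HN n a T.-1 _ Nn ha b_lt HP) upC; rewrite leq_subLR => h.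
  have : T.-1%:R <= a%:R + n.-1%:R - C%:R :> R.
    by rewrite -addrA -natrB // -natrD ler_nat.
  have : T%:R <= T.-1%:R + 1 :> R by rewrite natr1 ler_nat leqSpred.
  by move: T2; rewrite -/T -natr1 /a -[X in X%:R + n.-1%:R]addn1 natrD; lra.
have lb : n%:R * F_limit x - c * n%:R - 3%:R <= C%:R.
  have M_ge0 := addr_ge0 cn_ge0 nF_ge0; set M := _ + _ in M_ge0.
  pose a := (Num.truncn M).+1.
  have /andP[a1 a2] := truncn_itv M_ge0.
  have ha : c * n%:R <= a%:R by rewrite (@le_trans _ _ M) ?lerDl // ltW.
  have b_lt : (n.-1 < n)%N by rewrite prednK.
  have HP j z : (a <= j < n.-1)%N -> node R n j.+1 < z < node R n j -> z <= x.
    move=> /andP[aj jn] /andP[_ z1]; rewrite (le_trans (ltW z1)) //.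
    apply: F_limit_node_lt; first by rewrite (ltn_trans jn).
    by rewrite (@le_trans _ _ a%:R) ?ler_nat // (@le_trans _ _ M) ?lerDr // ltW.
  have := leq_trans (HN n a n.-1 _ Nn ha b_lt HP) lowC.
  rewrite leq_subLR -(ler_nat R) natrD /a -[X in X%:R + C%:R]addn1 natrD n1 => h.
  by move: a1 h; rewrite /M n1; lra.
by rewrite ler_norml; apply/andP; split; lra.
Qed.

Theorem theorem2p3 (R : realType) :
  (forall x : R, F_zeros n x @[n --> \oo] --> F_limit x)
  /\ (forall x : R, {for x, continuous (@F_limit R)} ->
        F_zeros n x @[n --> \oo] --> F_limit x).
Proof.
suff cvgF (x : R) : F_zeros n x @[n --> \oo] --> F_limit x by split=> x.
apply/cvgrPdist_le => e e_gt0.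
have e2 : 0 < e / 2%:R by rewrite divr_gt0.
have [N HN] := count_zeros_close e2.
(* for n - 1 > M, the error (e/2) n + 3 + 1 of the counts is at most e (n - 1) *)
pose M := Num.truncn (2%:R * (e / 2%:R + 4%:R) / e).
exists (maxn N M.+3) => // n /=; rewrite geq_max => /andP[Nn Mn].
have n_gt1 : (1 < n)%N by exact: leq_trans Mn.
have := HN n x Nn n_gt1; rewrite F_zerosE; move: (count _ _)%:R => C HC.
have n1 : n%:R = n.-1%:R + 1 :> R by rewrite natr1 prednK // ltnW.
have p_gt0 : 0 < n.-1%:R :> R by rewrite ltr0n -ltnS prednK // ltnW.
have F_ge0 := F_limit_ge0 x; have F_le1 := F_limit_le1 x.
have pM : 2%:R * (e / 2%:R + 4%:R) <= n.-1%:R * e.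
  rewrite -ler_pdivrMr // ltW // (lt_le_trans (truncnS_gt _)) // ler_nat -/M.
  by rewrite -ltnS prednK ?(ltnW n_gt1) // ltnW.
rewrite distrC.
have -> : n.-1%:R^-1 * C - F_limit x = (C - n.-1%:R * F_limit x) / n.-1%:R.
  by field; rewrite lt0r_neq0.
rewrite normrM normfV (gtr0_norm p_gt0) ler_pdivrMr //.
have -> : C - n.-1%:R * F_limit x = (C - n%:R * F_limit x) + F_limit x.
  by rewrite n1; ring.
rewrite (le_trans (ler_normD _ _)) // (ger0_norm F_ge0).
move: HC pM; rewrite n1; lra.
Qed.
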